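(* Assume that the probability functions $\lambda_i:[0,1]\to[0,1]$, $i=1,\dots,n$, satisfy (A1)–(A3) and are Lipschitz continuous. Then for all integers $T\ge 1$ the Markov chain $z(k)$ on $\Sigma^T$ with finite averaging described in the context has a unique invariant and attractive probability measure $\pi^T$ on $\Sigma^T$. Furthermore, for all $z_0\in\Sigma^T$, the chain $z(\cdot;z_0)$ started at $z_0$ satisfies almost surely $$\lim_{k\to\infty}\frac1k\sum_{\ell=0}^k z(\ell;z_0)=\int_{\Sigma^T}z\,\mathrm{d}\pi^T(z).$$
   Context: Let $\Sigma=\{x\in\mathbb{R}^n: x_i\ge 0,\ \sum_{i=1}^n x_i=1\}$, $\mathrm{ri}\,\Sigma=\{x\in\Sigma: x_i>0\ \forall i\}$, $e=(1,\dots,1)^\top$. AIMD matrices: fix $\alpha\in\mathrm{ri}\,\Sigma$ and $\beta\in(0,1)^n$ such that $\alpha_i/(1-\beta_i)$ is independent of $i$. Let $B=\{\tilde\beta\in\mathbb{R}^n:\tilde\beta_i\in\{\beta_i,1\}\ \forall i\}$ and $\mathcal{A}=\{\mathrm{diag}(\tilde\beta)+\alpha(e-\tilde\beta)^\top:\tilde\beta\in B\}$. Assumptions: (A1) each $\lambda_i$ is continuous; (A2) $r\mapsto r\lambda_i(r)$ is strictly increasing on $[0,1]$ for each $i$; (A3) there is a constant $\lambda_{\min}>0$ with $\lambda_i(r)\ge\lambda_{\min}$ for all $r\in[0,1]$ and all $i$. For $y\in\Sigma$ and the matrix $A\in\mathcal{A}$ corresponding to $\tilde\beta\in B$ put $p_A(y)=\prod_{i:\tilde\beta_i=\beta_i}\lambda_i(y_i)\prod_{i:\tilde\beta_i=1}(1-\lambda_i(y_i))$.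 Finite-averaging chain: for $A\in\mathcal{A}$ define $A_T\in\mathbb{R}^{Tn\times Tn}$ acting on $z=(z_1,\dots,z_T)$, $z_i\in\mathbb{R}^n$, by $(A_Tz)_1=Az_1$ and $(A_Tz)_i=\frac1iAz_1+\frac{i-1}{i}z_{i-1}$ for $i=2,\dots,T$. The chain is $z(k+1)=A_T(k)z(k)$ on $\Sigma^T$, where, conditionally on the past, $A_T(k)$ equals the matrix $A_T$ built from $A\in\mathcal{A}$ with probability $p_A(z_T(k))$, with $z_T(k)\in\Sigma$ the $T$-th block component of $z(k)$. (This models $x(k+1)=A(k)x(k)$ with $z_i(k)=\frac1i\sum_{j=0}^{i-1}x(k-j)$.) A measure $\pi^T$ is attractive if for every initial probability distribution on $\Sigma^T$ the distribution of $z(k)$ converges weakly to $\pi^T$ as $k\to\infty$. *)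

(* Defs.v *)
From HB Require Import structures.
From mathcomp Require Import all_boot all_order all_algebra.
From mathcomp Require Import all_classical all_reals all_analysis.

Set Implicit Arguments.
Unset Strict Implicit.
Unset Printing Implicit Defensive.

Import Order.TTheory GRing.Theory Num.Theory.
Import numFieldNormedType.Exports.

Local Open Scope classical_set_scope.
Local Open Scope ring_scope.

(* The Borel sigma-algebra on real matrices. *)
HB.instance Definition _ (R : realType) (m n : nat) :=
  Measurable.copy 'M[R]_(m, n) (g_sigma_algebraType (@open 'M[R]_(m, n))).

Definition simplex (R : realType) (n : nat) : set 'cV[R]_n :=
  [set x | (forall i, 0 <= x i 0) /\ \sum_i x i 0 = 1].

Definition ri_simplex (R : realType) (n : nat) : set 'cV[R]_n :=
  [set x | simplex x /\ forall i, 0 < x i 0].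

(* A point z = (z_1, ..., z_T) with z_i in R^n is the n x T matrix whose
   (zero-based) column j is z_(j+1).  As T >= 1, the number of blocks is
   written T.+1 from here on, and the last block is column ord_max. *)
Definition simplexT (R : realType) (n T : nat) : set 'M[R]_(n, T.+1) :=
  [set z | forall j, simplex (col j z)].

(* An element of B is given by the set S of the indices i at which it takes the
   value beta_i; since beta_i < 1 this is a bijection between subsets and B. *)
Definition tbeta (R : realType) (n : nat) (beta : 'cV[R]_n) (S : {set 'I_n}) :
    'cV[R]_n :=
  \col_i (if i \in S then beta i 0 else 1).

Definition aimd_mx (R : realType) (n : nat) (alpha beta : 'cV[R]_n)
    (S : {set 'I_n}) : 'M[R]_n :=
  diag_mx (tbeta beta S)^T + alpha *m (const_mx 1 - tbeta beta S)^T.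

Definition aimd_prob (R : realType) (n : nat) (lam : 'I_n -> R -> R)
    (S : {set 'I_n}) (y : 'cV[R]_n) : R :=
  (\prod_(i in S) lam i (y i 0)) * \prod_(i in ~: S) (1 - lam i (y i 0)).

(* z |-> A_T z; the factors 1/i and (i-1)/i are read at i = j.+1. *)
Definition avg_map (R : realType) (n T : nat) (A : 'M[R]_n)
    (z : 'M[R]_(n, T.+1)) : 'M[R]_(n, T.+1) :=
  \matrix_(i, j)
    if j == ord0 then (A *m col ord0 z) i 0
    else j.+1%:R^-1 * (A *m col ord0 z) i 0
         + j%:R / j.+1%:R * z i (inord j.-1).

Section chain.
Context (R : realType) (n T : nat).
Variables (alpha beta : 'cV[R]_n) (lam : 'I_n -> R -> R).
Local Notation X := 'M[R]_(n, T.+1).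

Definition chain_step (S : {set 'I_n}) (z : X) : X :=
  avg_map (aimd_mx alpha beta S) z.

Definition chain_trans (z : X) (C : set X) : \bar R :=
  (\sum_(S : {set 'I_n}) (aimd_prob lam S (col ord_max z))%:E
     * \d_(chain_step S z) C)%E.

(* The distribution of z(k) when z(0) has distribution mu, as a set function;
   only its values on Borel sets enter the integrals below. *)
Fixpoint chain_law (mu : set X -> \bar R) (k : nat) : set X -> \bar R :=
  if k is k'.+1 then
    fun C => (\int[chain_law mu k']_(z in @simplexT R n T) chain_trans z C)%E
  else mu.

Definition invariant_prob (pi : probability X R) : Prop :=
  forall C : set X, measurable C -> chain_law pi 1 C = pi C.

Definition weak_cvg (mu : nat -> set X -> \bar R) (pi : set X -> \bar R) : Prop :=
  forall f : X -> R,
    {within @simplexT R n T, continuous f} ->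
    [bounded f z | z in @simplexT R n T] ->
    (fun k => \int[mu k]_(z in @simplexT R n T) (f z)%:E)%E @ \oo -->
      (\int[pi]_(z in @simplexT R n T) (f z)%:E)%E.

Definition attractive_prob (pi : probability X R) : Prop :=
  forall mu : probability X R, mu (@simplexT R n T) = 1%E ->
    weak_cvg (chain_law mu) pi.

(* The events of the sigma-algebra generated by z(0), ..., z(k). *)
Definition chain_past (Om : Type) (z : nat -> Om -> X) (k : nat) : set (set Om) :=
  <<s [set E | exists j (C : set X),
         [/\ (j <= k)%N, measurable C & E = z j @^-1` C]] >>.

(* The chain z(.; z0), driven by the random choices S(k) of A(k).  The integral
   condition says that, given z(0), ..., z(k), the choice S(k) equals s with
   conditional probability p_s(z_T(k)).  Conditioning on a larger past, such as
   one which also contains S(0), ..., S(k-1), is a stronger requirement. *)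
Definition is_chain (d : measure_display) (Om : measurableType d)
    (P : probability Om R) (z0 : X)
    (S : nat -> Om -> {set 'I_n}) (z : nat -> {mfun Om >-> X}) : Prop :=
  [/\ forall k s, measurable (S k @^-1` [set s]),
      forall w, z 0%N w = z0,
      forall k w, z k.+1 w = chain_step (S k w) (z k w)
    & forall k s (E : set Om), chain_past z k E ->
        P (E `&` S k @^-1` [set s]) =
        (\int[P]_(w in E) (aimd_prob lam s (col ord_max (z k w)))%:E)%E].

End chain.

(* Main.v *)
(* In the norm max_j c^j |z_j|_1, with c = max_i beta_i, no A_T expands on
   differences of points of the product of simplices, and the one in which every
   agent backs off contracts by c; this one is chosen with probability bounded
   below, and the choice probabilities are Lipschitz.  Hence, for the transfer
   operator U of the chain, a weighted sum of the oscillation and of the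
   Lipschitz constant of U^k f decreases geometrically, so that U^k f converges
   uniformly to a constant Lam f, for every continuous f.  The Riesz measure pi
   of the functional Lam is invariant, attractive and unique.  For the almost
   sure convergence, h = sum_(i < N) U^i f satisfies h - U h =
     f - U^N f, and the
   right-hand side is uniformly close to f - Lam f; so the sums of f - Lam f
   along the chain are, up to a small multiple of k and a bounded term, a
   martingale with bounded increments, whose second moment grows linearly and
   which is therefore o(k) almost surely (along the squares by summability, and
   in between by boundedness of the increments). *)
Require Import Defs.
From HB Require Import structures.
From mathcomp Require Import all_boot all_order all_algebra.
From mathcomp Require Import all_classical all_reals all_analysis.
From mathcomp Require Import measurable_realfun zify ring lra.

Set Implicit Arguments.
Unset Strict Implicit.
Unset Printing Implicit Defensive.

Import Order.TTheory GRing.Theory Num.Theory.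
Import numFieldNormedType.Exports.

Local Open Scope classical_set_scope.
Local Open Scope ring_scope.

(** * Bounded, uniformly continuous functions *)

(** Since the choice probabilities depend on the place, contraction on average does not make
    Lipschitz constants decay: each step adds to them a multiple of the oscillation. The oscillation
    itself drops only over many steps: from any two points the full back-off is chosen N times in a
    row with probability at least p0^N, and this brings the points within c^N D of each other, where
    D bounds all distances. The two quantities are therefore controlled together, over blocks of N
    steps. The iterated law of the chain is a bare set function. At each time it is compared on
    Borel sets with a genuine probability measure, for which integration is dual to the transfer
    operator. For the law of large numbers, a deterministic starting point and a finite set of
    choices leave only finitely many possible histories up to time k, so that conditioning on the
    past becomes a finite sum. *)

Definition bucont (R : realType) (X : Type) (K : set X) (d : X -> X -> R)
    (f : X -> R) : Prop :=
  (exists M, forall x, K x -> `|f x| <= M) /\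
  forall e, 0 < e -> exists2 dl, 0 < dl &
    forall x y, K x -> K y -> d x y < dl -> `|f x - f y| <= e.

Section bucont_theory.
Context {R : realType} {X : Type} {K : set X} {d : X -> X -> R}.

Lemma bucont_cst c : bucont K d (fun=> c).
Proof.
split=> [|e e0]; first by exists `|c|.
by exists 1 => // x y _ _ _; rewrite subrr normr0 ltW.
Qed.

Lemma bucontD f g :
  bucont K d f -> bucont K d g -> bucont K d (fun x => f x + g x).
Proof.
move=> [[A fA] uf] [[B gB] ug]; split=> [|e e0].
  by exists (A + B) => x Kx; rewrite (le_trans (ler_normD _ _))// lerD ?fA ?gB.
have e20 : 0 < e / 2 by rewrite divr_gt0.
have [a a0 fa] := uf _ e20; have [b b0 gb] := ug _ e20.
exists (Num.min a b) => [|x y Kx Ky]; first by rewrite lt_min a0.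
rewrite lt_min => /andP[/(fa _ _ Kx Ky) fxy /(gb _ _ Kx Ky) gxy].
rewrite [e]splitr (_ : _ - _ = (f x - f y) + (g x - g y)); last by ring.
by rewrite (le_trans (ler_normD _ _))// lerD.
Qed.

(** Treats every composition with a Lipschitz function at once: scaling, negation, truncation, and
    change of values off [K]. A bound for [g] comes from the bound for [f] and a single value of
    [g]. *)
Lemma bucont_le f g C :
  (forall x y, K x -> K y -> `|g x - g y| <= C * `|f x - f y|) ->
  bucont K d f -> bucont K d g.
Proof.
move=> fg [[A fA] uf].
have C0 : 0 < `|C| + 1 by rewrite ltr_wpDl.
have {}fg x y : K x -> K y -> `|g x - g y| <= (`|C| + 1) * `|f x - f y|.
  move=> Kx Ky; rewrite (le_trans (fg _ _ Kx Ky))//.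
  by rewrite ler_wpM2r// (le_trans (ler_norm C))// lerDl.
split=> [|e e0].
  have [[y Ky]|K0] := pselect (K !=set0); last first.
    by exists 0 => x Kx; exfalso; apply: K0; exists x.
  exists ((`|C| + 1) * (A + A) + `|g y|) => x Kx.
  rewrite -[g x](subrK (g y)) (le_trans (ler_normD _ _))// lerD2r.
  rewrite (le_trans (fg _ _ Kx Ky))// ler_wpM2l ?(ltW C0)//.
  by rewrite (le_trans (ler_normB _ _))// lerD ?fA.
have [|a a0 fa] := uf (e / (`|C| + 1)); first by rewrite divr_gt0.
exists a => // x y Kx Ky /(fa _ _ Kx Ky) fxy.
by rewrite (le_trans (fg _ _ Kx Ky))// -ler_pdivlMl// mulrC.
Qed.

Lemma bucontZ c f : bucont K d f -> bucont K d (fun x => c * f x).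
Proof.
by apply: (@bucont_le _ _ `|c|) => x y _ _; rewrite -mulrBr normrM.
Qed.

Lemma bucontN f : bucont K d f -> bucont K d (fun x => - f x).
Proof.
by apply: (@bucont_le _ _ 1) => x y _ _; rewrite -opprD normrN mul1r.
Qed.

Lemma bucontB f g :
  bucont K d f -> bucont K d g -> bucont K d (fun x => f x - g x).
Proof. by move=> uf /bucontN; exact: bucontD. Qed.

Lemma bucont_eq f g : {in K, f =1 g} -> bucont K d f -> bucont K d g.
Proof.
move=> fg; apply: (@bucont_le _ _ 1) => x y Kx Ky.
by rewrite mul1r !fg ?inE.
Qed.

Lemma bucont_sum (I : Type) (r : seq I) (F : I -> X -> R) :
  (forall i, bucont K d (F i)) -> bucont K d (fun x => \sum_(i <- r) F i x).
Proof.
move=> uF; elim: r => [|i r IH].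
  by apply: bucont_eq (bucont_cst 0) => x _; rewrite big_nil.
by apply: bucont_eq (bucontD (uF i) IH) => x _; rewrite big_cons.
Qed.

Lemma bucontM f g :
  bucont K d f -> bucont K d g -> bucont K d (fun x => f x * g x).
Proof.
move=> [[A fA] uf] [[B gB] ug]; split=> [|e e0].
  by exists (A * B) => x Kx; rewrite normrM ler_pM ?fA ?gB.
pose C := `|A| + `|B| + 1; have C0 : 0 < C by rewrite /C ltr_wpDl// addr_ge0.
have e20 : 0 < e / 2 / C by rewrite !divr_gt0.
have [a a0 fa] := uf _ e20; have [b b0 gb] := ug _ e20.
exists (Num.min a b) => [|x y Kx Ky]; first by rewrite lt_min a0.
rewrite lt_min => /andP[/(fa _ _ Kx Ky) fxy /(gb _ _ Kx Ky) gxy].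
rewrite [e]splitr.
rewrite (_ : _ - _ = (f x - f y) * g y + f x * (g x - g y)); last by ring.
have le1 u v E : `|u| <= e / 2 / C -> `|v| <= E -> E <= C -> `|u * v| <= e / 2.
  move=> uC vE EC; rewrite normrM (@le_trans _ _ (e / 2 / C * C))//.
    by rewrite ler_pM// (le_trans vE).
  by rewrite divfK ?gt_eqF.
have AC : A <= C by rewrite (le_trans (ler_norm A))// /C -addrA lerDl addr_ge0.
have BC : B <= C.
  by rewrite (le_trans (ler_norm B))// /C -addrA addrCA lerDl addr_ge0.
rewrite (le_trans (ler_normD _ _))// lerD//; first exact:
  (le1 _ _ B _ (gB _ Ky)).
by rewrite mulrC; exact: (le1 _ _ A _ (fA _ Kx)).
Qed.

(** Points closer than the modulus [a] cost at most [e]; for all others the total variation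
    [2 * |A|] is at most [2 * |A| / a] times their distance. This affine bound stands in for a
    Lipschitz constant. *)
Lemma bucont_modulus f : (forall x y, 0 <= d x y) -> bucont K d f ->
  forall e, 0 < e -> exists2 l, 0 <= l &
    forall x y, K x -> K y -> `|f x - f y| <= l * d x y + e.
Proof.
move=> d0 [[A fA] uf] e e0; have [a a0 fa] := uf _ e0.
exists ((`|A| + `|A|) / a) => [|x y Kx Ky]; first by rewrite divr_ge0
  ?addr_ge0// ltW.
have [/(fa _ _ Kx Ky) /le_trans->//|ad] := ltP (d x y) a.
  by rewrite lerDr mulr_ge0// divr_ge0 ?addr_ge0// ltW.
rewrite (@le_trans _ _ (`|A| + `|A|))//.
  by rewrite (le_trans (ler_normB _ _))// lerD// (le_trans (fA _ _))// ler_norm.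
rewrite ler_wpDr ?(ltW e0)// mulrAC -mulrA ler_peMr ?addr_ge0//.
by rewrite ler_pdivlMr// mul1r.
Qed.

End bucont_theory.

(** * The transfer operator of a place-dependent iterated function system *)

Section transfer_operator.
Context {R : realType} {X : Type} {I : finType}.
Variables (w : I -> X -> X) (p : I -> X -> R).

Definition transfer (f : X -> R) (x : X) : R := \sum_s p s x * f (w s x).

Lemma transferD f g x :
  transfer (fun x => f x + g x) x = transfer f x + transfer g x.
Proof. by rewrite /transfer -big_split; apply: eq_bigr => s _;
  rewrite mulrDr. Qed.

Lemma transferZ c f x : transfer (fun x => c * f x) x = c * transfer f x.
Proof. by rewrite /transfer mulr_sumr; apply: eq_bigr => s _;
  rewrite mulrCA. Qed.

Lemma iter_transferD k f g x : iter k transfer (fun x => f x + g x) x =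
  iter k transfer f x + iter k transfer g x.
Proof.
elim: k x => //= k IH x; rewrite -transferD.
by congr (transfer _ x); apply/funext => y; exact: IH.
Qed.

Lemma iter_transferZ k c f x : iter k transfer (fun x => c * f x) x =
  c * iter k transfer f x.
Proof.
elim: k x => //= k IH x; rewrite -transferZ.
by congr (transfer _ x); apply/funext => y; exact: IH.
Qed.

Variable K : set X.
Hypothesis wK : forall s x, K x -> K (w s x).
Hypothesis p_ge0 : forall s x, K x -> 0 <= p s x.
Hypothesis p_sum1 : forall x, K x -> \sum_s p s x = 1.

Lemma le_transfer f g x : K x -> (forall x, K x -> f x <= g x) ->
  transfer f x <= transfer g x.
Proof.
by move=> Kx fg; apply: ler_sum => s _; rewrite ler_wpM2l ?p_ge0// fg//;
  exact: wK.
Qed.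

Lemma eq_transfer f g x : K x -> {in K, f =1 g} -> transfer f x = transfer g x.
Proof.
by move=> Kx fg; apply: eq_bigr => s _; rewrite fg// inE; exact: wK.
Qed.

Lemma transfer_cst c x : K x -> transfer (fun=> c) x = c.
Proof. by move=> Kx; rewrite /transfer -mulr_suml p_sum1// mul1r. Qed.

Lemma le_iter_transfer k f g x : K x -> (forall x, K x -> f x <= g x) ->
  iter k transfer f x <= iter k transfer g x.
Proof. by elim: k x => [|k IH] x Kx fg; [exact: fg | apply: le_transfer => //
  y /IH; exact]. Qed.

Lemma iter_transfer_cst k c x : K x -> iter k transfer (fun=> c) x = c.
Proof.
elim: k x => //= k IH x Kx; rewrite -[RHS](@transfer_cst c x)//.
by apply: eq_transfer => // y; rewrite inE; exact: IH.
Qed.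

Lemma transfer_bnd f a b x : K x -> (forall x, K x -> a <= f x <= b) ->
  a <= transfer f x <= b.
Proof.
move=> Kx fab; apply/andP; split.
  by rewrite -{1}(transfer_cst a Kx); apply: le_transfer => // y /fab /andP[].
by rewrite -[leRHS](transfer_cst b Kx); apply: le_transfer => // y /fab /andP[].
Qed.

Lemma iter_transfer_bnd k f a b x : K x -> (forall x, K x -> a <= f x <= b) ->
  a <= iter k transfer f x <= b.
Proof.
by elim: k x => [|k IH] x Kx fab; [exact: fab | apply: transfer_bnd => //
  y /IH; exact].
Qed.

(** * Decay of the oscillation under iteration of the transfer operator *)

Variables (d : X -> X -> R) (s0 : I) (c p0 L D : R).
Hypothesis d_ge0 : forall x y, 0 <= d x y.
Hypothesis dD : forall x y, K x -> K y -> d x y <= D.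
Hypothesis wd : forall s x y, K x -> K y -> d (w s x) (w s y) <= d x y.
Hypothesis w0d : forall x y, K x -> K y -> d (w s0 x) (w s0 y) <= c * d x y.
Hypothesis c_itv : 0 <= c < 1.
Hypothesis p0_itv : 0 < p0 < 1.
Hypothesis p_s0 : forall x, K x -> p0 <= p s0 x.
Hypothesis pL : forall x y, K x -> K y -> \sum_s `|p s x - p s y| <= L * d x y.

(* [eta] is a slack that makes the estimates apply to every uniformly
   continuous function and not only to the Lipschitz ones. *)
Let osc_lip (h : X -> R) (o l eta : R) := forall x y, K x -> K y ->
  `|h x - h y| <= o /\ `|h x - h y| <= l * d x y + eta.

Let r := 1 - p0 * (1 - c).

(** Moving both points by the same choice multiplies the Lipschitz constant by at most [r] on
    average, as [s0] has probability at least [p0] and contracts by [c]. The mismatch between the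
    two choice distributions costs at most [L * d x y] times the oscillation. *)
Let transfer_lip h o l eta : 0 <= l -> osc_lip h o l eta ->
  forall x y, K x -> K y ->
  `|transfer h x - transfer h y| <= (r * l + L * o) * d x y + eta.
Proof.
move=> l0 hh x y Kx Ky.
have -> : transfer h x - transfer h y =
    \sum_s p s x * (h (w s x) - h (w s y)) +
    \sum_s (p s x - p s y) * (h (w s y) - h y).
  rewrite -big_split/=.
  transitivity (\sum_s (p s x * h (w s x) - p s y * h (w s y))).
    by rewrite sumrB.
  (* Both distributions have mass 1, so [h y] may be subtracted inside the mismatch term, which then
     involves only differences of values of [h]. *)
  transitivity (\sum_s (p s x * h (w s x) - p s y * h (w s y))
      - \sum_s (p s x - p s y) * h y).
    have -> : \sum_s (p s x - p s y) * h y = 0.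
      by rewrite -mulr_suml sumrB !p_sum1// subrr mul0r.
    by rewrite subr0.
  by rewrite -sumrB; apply: eq_bigr => s _; ring.
apply: le_trans (ler_normD _ _) _.
have o0 : 0 <= o by have [/(le_trans (normr_ge0 _))] := hh _ _ Kx Kx.
have l2 : `|\sum_s (p s x - p s y) * (h (w s y) - h y)| <= L * d x y * o.
  apply: le_trans (ler_norm_sum _ _ _) _.
  apply: le_trans (ler_wpM2r o0 (pL Kx Ky)); rewrite mulr_suml.
  apply: ler_sum => s _; rewrite normrM ler_wpM2l//.
  by have [] := hh _ _ (wK s Ky) Ky.
have l1 : `|\sum_s p s x * (h (w s x) - h (w s y))| <= r * l * d x y + eta.
  apply: le_trans (ler_norm_sum _ _ _) _.
  apply: (@le_trans _ _ (\sum_s p s x * (l * d x y + eta) -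
     p s0 x * (l * (1 - c) * d x y))).
    rewrite (bigD1 s0)//= [in leRHS](bigD1 s0)//= addrAC lerD//.
      rewrite normrM (ger0_norm (p_ge0 s0 Kx)) -mulrBr ler_wpM2l ?p_ge0//.
      have [_ /le_trans->//] := hh _ _ (wK s0 Kx) (wK s0 Ky).
      rewrite -addrA (addrC eta) addrA lerD2r.
      have -> : l * d x y - l * (1 - c) * d x y = l * (c * d x y) by ring.
      by rewrite ler_wpM2l// w0d.
    apply: ler_sum => s _.
    rewrite normrM (ger0_norm (p_ge0 s Kx)) ler_wpM2l ?p_ge0//.
    have [_ /le_trans->//] := hh _ _ (wK s Kx) (wK s Ky).
    by rewrite lerD2r ler_wpM2l// wd.
  rewrite -mulr_suml p_sum1// mul1r.
  have : p0 * (l * (1 - c) * d x y) <= p s0 x * (l * (1 - c) * d x y).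
    rewrite ler_wpM2r ?p_s0// !mulr_ge0//.
    by case/andP: c_itv => _ /ltW; rewrite subr_ge0.
  by rewrite /r; lra.
have -> : (r * l + L * o) * d x y + eta = r * l * d x y + eta + L * d x y * o
  by ring.
exact: lerD.
Qed.

(** The mass [p0] on [s0] is common to both points and can be coupled; the remainders [q],
    nonnegative and of mass [1 - p0], contribute at most their mass times the oscillation. *)
Let transfer_osc h o : (forall x y, K x -> K y -> `|h x - h y| <= o) ->
  forall x y, K x -> K y ->
  `|transfer h x - transfer h y| <= p0 * `|h (w s0 x) - h (w s0 y)| + (1 - p0)
    * o.
Proof.
move=> ho x y Kx Ky; have /andP[p00 p01] := p0_itv.
pose q s z := p s z - (s == s0)%:R * p0.
have q0 s z : K z -> 0 <= q s z.
  move=> Kz; rewrite /q; case: eqP => [->|_]; rewrite ?mul1r ?mul0r ?subr0.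
    by rewrite subr_ge0 p_s0.
  exact: p_ge0.
have qE z : K z -> \sum_s q s z = 1 - p0.
  move=> Kz; rewrite sumrB p_sum1// -mulr_suml; congr (1 - _).
  rewrite (bigD1 s0)//= eqxx big1 ?addr0 ?mul1r// => i /negbTE ->//.
have tE z : transfer h z = p0 * h (w s0 z) + \sum_s q s z * h (w s z).
  rewrite /transfer.
  rewrite (_ : p0 * _ = \sum_s (s == s0)%:R * p0 * h (w s z)).
    by rewrite -big_split/=; apply: eq_bigr => s _; rewrite /q; ring.
  rewrite (bigD1 s0)//= eqxx big1 ?addr0 ?mul1r// => i /negbTE ->.
  by rewrite !mul0r.
clearbody q; rewrite !tE [X in `|X|](_ : _ = p0 * (h (w s0 x) - h (w s0 y)) +
   (\sum_s q s x * h (w s x) - \sum_s q s y * h (w s y))); last by ring.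
rewrite (le_trans (ler_normD _ _))// normrM (gtr0_norm p00) lerD2l.
have p10 : 0 < 1 - p0 by rewrite subr_gt0.
(* After multiplication by the mass [1 - p0], the difference of the two remainder sums is an
   integral against the product of the remainders at [x] and at [y], that is, an independent
   coupling. *)
rewrite -(ler_pM2l p10) -[X in X * `|_|](gtr0_norm p10) -normrM mulrBr.
have -> : (1 - p0) * (\sum_s q s x * h (w s x)) -
    (1 - p0) * (\sum_s q s y * h (w s y)) =
    \sum_s \sum_t q s x * q t y * (h (w s x) - h (w t y)).
  rewrite -{1}(qE _ Ky) -{1}(qE _ Kx) mulrC.
  transitivity (\sum_s (\sum_t q s x * q t y * h (w s x)
     - \sum_t q s x * q t y * h (w t y))); last first.
    by apply: eq_bigr => s _; rewrite -sumrB; apply: eq_bigr => t _;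
      rewrite mulrBr.
  rewrite sumrB; congr (_ - _); rewrite mulr_suml; apply: eq_bigr => s _;
    rewrite mulr_sumr; apply: eq_bigr => t _; ring.
apply: le_trans (ler_norm_sum _ _ _) _.
apply: (@le_trans _ _ (\sum_s \sum_t q s x * q t y * o)).
  apply: ler_sum => s _; apply: le_trans (ler_norm_sum _ _ _) _.
  apply: ler_sum => t _; rewrite normrM ger0_norm ?mulr_ge0 ?q0//.
  by rewrite ler_wpM2l ?mulr_ge0 ?q0// ho//; exact: wK.
rewrite mulrA -{1}(qE _ Kx) -{1}(qE _ Ky) mulr_suml mulr_suml.
by apply: ler_sum => s _; rewrite mulr_sumr mulr_suml.
Qed.

(** With common mass [p0 ^+ N] the choice [s0] is made at all [N] steps for both points; the rest of
    the mass sees at most the oscillation [o]. *)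
Let iter_transfer_osc N h o : (forall x y, K x -> K y -> `|h x - h y| <= o) ->
  forall x y, K x -> K y ->
  `|iter N transfer h x - iter N transfer h y| <=
    p0 ^+ N * `|h (iter N (w s0) x) - h (iter N (w s0) y)| + (1 - p0 ^+ N) * o.
Proof.
move=> ho; have /andP[p00 p01] := p0_itv.
have o0 x : K x -> 0 <= o by move=> Kx; rewrite (le_trans _ (ho x x Kx Kx)).
elim: N => [|N IH] x y Kx Ky; first by rewrite /= expr0 mul1r subrr mul0r addr0.
rewrite [iter _ transfer h]iterS (le_trans (transfer_osc (o := o) _ _ _))//.
  move=> {}x {}y {}Kx {}Ky; apply: le_trans (IH _ _ Kx Ky) _.
  apply: (@le_trans _ _ (p0 ^+ N * o + (1 - p0 ^+ N) * o)).
    rewrite lerD2r ler_wpM2l ?exprn_ge0 ?(ltW p00)// ho//.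
      by elim: {IH} N => //= n; exact: wK.
    by elim: {IH} N => //= n; exact: wK.
  by rewrite -mulrDl addrC subrK mul1r.
rewrite !iterSr (le_trans (lerD (ler_wpM2l (ltW p00) (IH _ _ (wK s0 Kx) (wK s0
  Ky))) (lexx _)))//.
by rewrite exprS; lra.
Qed.

Hypothesis L_ge0 : 0 <= L.

Let r_itv : 0 <= r < 1.
Proof.
have /andP[c0 c1] := c_itv; have /andP[p00 p01] := p0_itv.
rewrite /r subr_ge0 ltrBlDr ltrDl mulr_gt0 ?subr_gt0// andbT.
by rewrite mulr_ile1 ?(ltW p00) ?(ltW p01) ?subr_ge0 ?(ltW c1)// lerBlDr lerDl.
Qed.

(** Sum of the series L (1 + r + r^2 + ...): the Lipschitz constant that an oscillation of size 1
    can build up over any number of steps. *)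
Let M := L / (1 - r).

Let ME : r * M + L = M.
Proof.
have : 1 - r != 0 by rewrite gt_eqF// subr_gt0; case/andP: r_itv.
by rewrite /M => ?; field.
Qed.

Let M_ge0 : 0 <= M.
Proof. by rewrite divr_ge0// subr_ge0 ltW//; case/andP: r_itv. Qed.

Let iter_osc_lip N h o l eta : 0 <= l -> osc_lip h o l eta ->
  osc_lip (iter N transfer h) o (r ^+ N * l + M * o) eta.
Proof.
move=> l0 hh; elim: N => [|N IH] x y Kx Ky.
  have [ho hl] := hh _ _ Kx Ky; split=> //=; rewrite (le_trans hl)// lerD2r.
  by rewrite ler_wpM2r// expr0 mul1r lerDl mulr_ge0// (le_trans _ ho).
have o0 : 0 <= o by have [/(le_trans (normr_ge0 _))] := hh _ _ Kx Kx.
split; rewrite iterS.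
  apply: le_trans (transfer_osc (o := o) _ Kx Ky) _.
    by move=> {}x {}y {}Kx {}Ky; case: (IH _ _ Kx Ky).
  have [h1 _] := IH _ _ (wK s0 Kx) (wK s0 Ky).
  have /andP[p00 p01] := p0_itv.
  have := ler_wpM2l (ltW p00) h1; lra.
have l'0 : 0 <= r ^+ N * l + M * o.
  have /andP[r0 _] := r_itv.
  exact: addr_ge0 (mulr_ge0 (exprn_ge0 _ r0) l0) (mulr_ge0 M_ge0 o0).
rewrite (le_trans (transfer_lip l'0 IH Kx Ky))// lerD2r ler_wpM2r//.
by rewrite exprS -{2}ME le_eqVlt; apply/orP; left; apply/eqP; ring.
Qed.

Let iter_w0 N x y : K x -> K y ->
  d (iter N (w s0) x) (iter N (w s0) y) <= c ^+ N * D.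
Proof.
have /andP[c0 c1] := c_itv; move=> Kx Ky; elim: N => [|N IH] /=.
  by rewrite expr0 mul1r dD.
have KN z : K z -> K (iter N (w s0) z) by move=> Kz; elim: {IH} N => //= n;
  exact: wK.
rewrite (le_trans (w0d (KN _ Kx) (KN _ Ky)))// exprS -mulrA.
by rewrite ler_wpM2l.
Qed.

Let block_osc_lip N h o l eta : 0 <= l -> osc_lip h o l eta ->
  osc_lip (iter N transfer h)
    (p0 ^+ N * (l * (c ^+ N * D) + eta) + (1 - p0 ^+ N) * o)
    (r ^+ N * l + M * o) eta.
Proof.
move=> l0 hh x y Kx Ky; split; last by have [] := iter_osc_lip N l0 hh Kx Ky.
apply: le_trans (iter_transfer_osc (o := o) N _ Kx Ky) _.
  by move=> {}x {}y {}Kx {}Ky; case: (hh _ _ Kx Ky).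
rewrite lerD2r ler_wpM2l ?exprn_ge0//; first by case/andP: p0_itv => /ltW.
have KN z : K z -> K (iter N (w s0) z) by move=> Kz; elim: N => //= n;
  exact: wK.
have [_ /le_trans->//] := hh _ _ (KN _ Kx) (KN _ Ky).
by rewrite lerD2r ler_wpM2l// iter_w0.
Qed.

(** The factor [2 * (M + 1)] is the ratio of the gain [p0 ^+ N] to the weight [eps] given below to
    the Lipschitz constant. It does not depend on [N], so that the powers of [r] and [c] can be made
    small against it. *)
Let exists_block : exists N,
  r ^+ N + 2 * (M + 1) * (c ^+ N * D) <= 2^-1.
Proof.
have cr : (fun N => r ^+ N + 2 * (M + 1) * (c ^+ N * D)) @ \oo -->
    0 + 2 * (M + 1) * (0 * D).
  apply: cvgD; first by apply: cvg_expr; rewrite ger0_norm; case/andP: r_itv.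
  apply: cvgMr; apply: cvgMl; apply: cvg_expr.
  by rewrite ger0_norm; case/andP: c_itv.
rewrite mul0r mulr0 addr0 in cr.
have [|N _ /(_ N (leqnn N))] := cvgr_le _ cr 2^-1; first by rewrite invr_gt0.
by exists N.
Qed.

(* Each block of [N] steps contracts the quantity [osc + eps * lip] up to an
   error of order [eta]; [eps] is chosen so that the term [M * osc] fed into the
   Lipschitz bound costs at most half of the gain [p0 ^+ N] on the oscillation.
     *)
Lemma iter_transfer_osc_small f : bucont K d f -> forall e, 0 < e ->
  exists k, forall x y, K x -> K y ->
    `|iter k transfer f x - iter k transfer f y| <= e.
Proof.
(* The bound reached at the end is [3 * eta]: a persistent error [2 * eta] and a transient one of at
   most [eta]. *)
move=> uf e e0; pose eta := e / 4; have eta0 : 0 < eta by rewrite divr_gt0.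
have [l l0 fl] := bucont_modulus d_ge0 uf eta0.
have [N rcN] := exists_block; have /andP[p00 p01] := p0_itv.
pose a := p0 ^+ N.
have a0 : 0 < a by rewrite exprn_gt0.
have a1 : a <= 1 by rewrite exprn_ile1// ltW.
pose eps := a / (2 * (M + 1)).
have M1 : 0 < 2 * (M + 1) by rewrite mulr_gt0// ltr_wpDl.
have eps0 : 0 < eps by rewrite divr_gt0.
have aE : a = eps * (2 * (M + 1)) by rewrite divfK// gt_eqF.
clearbody eps.
(* A block sends a bound [t] for the weighted sum to [q * t + a * eta], an affine map with fixed
   point [2 * eta]. *)
pose q := 1 - a / 2; have q01 : 0 <= q < 1 by rewrite /q; lra.
pose W := `|l * D + eta| + eps * l.
have [[z Kz]|K0] := pselect (K !=set0); last first.
  by exists 0%N => x y Kx; exfalso; apply: K0; exists x.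
have D0 : 0 <= D by rewrite (le_trans _ (dD Kz Kz)).
have step j : exists oj l', [/\ 0 <= oj, 0 <= l',
    osc_lip (iter (j * N) transfer f) oj l' eta & oj + eps * l' <=
      q ^+ j * W + 2 * eta].
  elim: j => [|j [oj [l' [oj0 l'0 hh hW]]]].
    exists `|l * D + eta|, l; split=> //.
      move=> x y Kx Ky; split; last exact: fl.
      apply: le_trans (ler_norm _); rewrite (le_trans (fl _ _ Kx Ky))//.
      by rewrite lerD2r ler_wpM2l ?dD.
    by rewrite expr0 mul1r ler_wpDr// mulr_ge0// ltW.
  exists (a * (l' * (c ^+ N * D) + eta) + (1 - a) * oj), (r ^+ N * l' + M * oj).
  have cN : 0 <= c ^+ N by rewrite exprn_ge0//; case/andP: c_itv.
  have rN : 0 <= r ^+ N by rewrite exprn_ge0//; case/andP: r_itv.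
  split; last 2 first.
  - by rewrite mulSn iterD; exact: block_osc_lip.
  - rewrite exprS.
    have h1 : eps * l' * (r ^+ N + 2 * (M + 1) * (c ^+ N * D)) <=
      eps * l' * 2^-1.
      by rewrite ler_wpM2l// mulr_ge0// ltW.
    have h2 : eps * M * oj <= a / 2 * oj.
      rewrite ler_wpM2r//; have : eps * (M + 1) = a / 2 by rewrite {1}aE; field.
      by rewrite mulrDr mulr1; move: (eps * M) eps0 => x e1 e2;
        rewrite -e2 lerDl ltW.
    have h3 : q * (oj + eps * l') <= q * (q ^+ j * W + 2 * eta).
      by rewrite ler_wpM2l//; case/andP: q01.
    have h4 : eps * l' * 2^-1 <= eps * l' * q.
      rewrite ler_wpM2l ?mulr_ge0 ?(ltW eps0)// /q; lra.
    have h5 : a * (l' * (c ^+ N * D)) = eps * l' * (2 * (M + 1) * (c ^+ N * D)).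
      by rewrite {1}aE; ring.
    have h6 : q * (2 * eta) + a * eta = 2 * eta by rewrite /q; field.
    have h7 : q * oj = (1 - a) * oj + a / 2 * oj by rewrite /q; field.
    rewrite mulrDr h5; lra.
  - rewrite addr_ge0// mulr_ge0 ?(ltW a0) ?subr_ge0// addr_ge0 ?(ltW eta0)//.
    by rewrite !mulr_ge0.
  - exact: addr_ge0 (mulr_ge0 rN l'0) (mulr_ge0 M_ge0 oj0).
have [j qj] : exists j, q ^+ j * W <= eta.
  have cq : (fun j => q ^+ j * W) @ \oo --> 0 * W.
    by apply: cvgMl; apply: cvg_expr; rewrite ger0_norm; case/andP: q01.
  rewrite mul0r in cq.
  by have [|j _ /(_ j (leqnn j))] := cvgr_le _ cq eta; [|exists j].
exists (j * N)%N => x y Kx Ky; have [oj [l' [oj0 l'0 hh hW]]] := step j.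
have [+ _] := hh _ _ Kx Ky; move=> /le_trans; apply.
have : 0 <= eps * l' by rewrite mulr_ge0// ltW.
by rewrite /eta in hW qj *; lra.
Qed.

(** * The limit functional of the iterates *)

Variable x0 : X.
Hypothesis Kx0 : K x0.

Definition transfer_lim (f : X -> R) : R := lim ((fun k =>
  iter k transfer f x0) @ \oo).

(** Once an iterate oscillates by at most [e] on [K], all later iterates are averages of its values
    and stay within [e] of its value at [x0]. This gives the Cauchy property, uniformity, and
    independence of the limit from the base point. *)
Lemma transfer_lim_unif f : bucont K d f -> forall e, 0 < e ->
  exists N, forall k x, (N <= k)%N -> K x ->
    `|iter k transfer f x - transfer_lim f| <= e.
Proof.
move=> uf; set u := fun k => iter k transfer f x0.
have near e : 0 < e -> exists N, forall k x, (N <= k)%N -> K x ->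
    `|iter k transfer f x - u N| <= e.
  move=> e0; have [N fN] := iter_transfer_osc_small uf e0.
  exists N => k x Nk Kx; rewrite -(subnK Nk) iterD ler_distl.
  by apply: iter_transfer_bnd => // y Ky; rewrite -ler_distl fN.
have cu : cvg (u @ \oo).
  apply/cauchy_cvgP/cauchy_exP => e e0; have [N uN] :=
    near _ (divr_gt0 e0 (ltr0n _ 2)).
  exists (u N); exists N => // k /= Nk; rewrite -ball_normE /ball_/= distrC.
  by rewrite (le_lt_trans (uN _ _ Nk Kx0))// ltr_pdivrMr// ltr_pMr// ltr1n.
move=> e e0; have [N uN] := near _ (divr_gt0 e0 (ltr0n _ 2));
  exists N => k x Nk Kx.
have lN : `|transfer_lim f - u N| <= e / 2.
  have cu' : (fun k => `|u k - u N|) @ \oo --> `|transfer_lim f - u N|.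
    by apply: cvg_norm; apply: cvgB => //; exact: cvg_cst.
  apply: (@cvgr_to_le _ _ _ _ _ _ _ cu'); exists N => // j /= Nj; exact: uN.
rewrite [e]splitr -(subrKA (u N)) (le_trans (ler_normD _ _))// lerD ?uN//.
by rewrite distrC.
Qed.

Lemma transfer_lim_cvg f x : bucont K d f -> K x ->
  iter k transfer f x @[k --> \oo] --> transfer_lim f.
Proof.
move=> uf Kx; apply/cvgrPdist_le => e e0.
have [N fN] := transfer_lim_unif uf e0.
by exists N => // k /= Nk; rewrite distrC fN.
Qed.

Lemma transfer_limD f g : bucont K d f -> bucont K d g ->
  transfer_lim (fun x => f x + g x) = transfer_lim f + transfer_lim g.
Proof.
move=> uf ug; apply: cvg_lim => //.
under eq_fun do rewrite iter_transferD.
by apply: cvgD; exact: transfer_lim_cvg.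
Qed.

Lemma transfer_limZ a f : bucont K d f ->
  transfer_lim (fun x => a * f x) = a * transfer_lim f.
Proof.
move=> uf; apply: cvg_lim => //.
under eq_fun do rewrite iter_transferZ.
by apply: cvgMr; exact: transfer_lim_cvg.
Qed.

Lemma le_transfer_lim f g : bucont K d f -> bucont K d g ->
  (forall x, K x -> f x <= g x) -> transfer_lim f <= transfer_lim g.
Proof.
move=> uf ug fg.
apply: ler_cvg_to (transfer_lim_cvg uf Kx0) (transfer_lim_cvg ug Kx0) _.
by apply: nearW => k; exact: le_iter_transfer.
Qed.

Lemma transfer_lim_cst a : transfer_lim (fun=> a) = a.
Proof.
apply: cvg_lim => //; under eq_fun do rewrite iter_transfer_cst//.
exact: cvg_cst.
Qed.

End transfer_operator.

(** * Distance functions and Borel sets of matrices *)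

Definition ndist (R : realType) (V : normedModType R) (x y : V) : R := `|x - y|.

Section dbump.
Context {R : realType} {V : normedModType R}.
Implicit Types (G : set V) (x y : V).

(* The value 1 keeps the infimum over a nonempty set when G is everything. *)
Definition dbump G (k : nat) x : R :=
  inf [set v | v = 1 \/ exists2 y, (~` G) y & v = k%:R * ndist x y].

Let dbump_lb G k x v :
  (forall y, (~` G) y -> v <= k%:R * ndist x y) -> v <= 1 -> v <= dbump G k x.
Proof.
move=> vG v1; apply: lb_le_inf; first by exists 1; left.
by move=> _ [->//|[y Gy ->]]; exact: vG.
Qed.

Let dbump_has_lb G k x :
  has_lbound [set v | v = 1 \/ exists2 y, (~` G) y & v = k%:R * ndist x y].
Proof.
by exists 0 => _ [->//|[y _ ->]]; rewrite mulr_ge0// normr_ge0.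
Qed.

Let dbump_le G k x y : (~` G) y -> dbump G k x <= k%:R * ndist x y.
Proof. by move=> Gy; apply: ge_inf; [exact: dbump_has_lb|right; exists y]. Qed.

Lemma dbump_ge0 G k x : 0 <= dbump G k x.
Proof. by apply: dbump_lb => // y _; rewrite mulr_ge0// normr_ge0. Qed.

Lemma dbump_le1 G k x : dbump G k x <= 1.
Proof. by apply: ge_inf; [exact: dbump_has_lb|left]. Qed.

Lemma dbump_out G k x : ~ G x -> dbump G k x = 0.
Proof.
move=> Gx; apply/eqP; rewrite eq_le dbump_ge0 andbT.
by rewrite (le_trans (dbump_le _ _ Gx))// /ndist subrr normr0 mulr0.
Qed.

Lemma dbump_nd G x : {homo dbump G ^~ x : k l / (k <= l)%N >-> k <= l}.
Proof.
move=> k l kl; apply: dbump_lb (dbump_le1 _ _ _) => y Gy.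
by rewrite (le_trans (dbump_le _ _ Gy))// ler_wpM2r ?normr_ge0// ler_nat.
Qed.

Lemma dbump_lip G k x y : `|dbump G k x - dbump G k y| <= k%:R * ndist x y.
Proof.
have h u v : dbump G k u <= dbump G k v + k%:R * ndist u v.
  rewrite -lerBlDr; apply: dbump_lb => [z Gz|]; last first.
    by rewrite lerBlDr (le_trans (dbump_le1 _ _ _))// lerDl mulr_ge0//
      normr_ge0.
  rewrite lerBlDr (le_trans (dbump_le _ _ Gz))// -mulrDr ler_wpM2l//.
  by rewrite addrC; exact: ler_distD.
rewrite ler_distl lerBlDr (h x y) andbT (le_trans (h y x))//.
by rewrite /ndist (distrC y).
Qed.

Lemma dbump_in G x : open G -> G x -> exists k, dbump G k x = 1.
Proof.
rewrite openE => oG /oG /nbhs_ballP[r/= r0 rG].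
exists (Num.truncn r^-1).+1; apply/eqP; rewrite eq_le dbump_le1/=.
apply: dbump_lb => // y Gy.
have ry : r <= ndist x y.
  rewrite leNgt; apply/negP => yr; apply: Gy; apply: rG.
  by rewrite -ball_normE.
have : r^-1 < (Num.truncn r^-1).+1%:R by exact: truncnS_gt.
move=> /ltW; rewrite -(ler_pM2r r0) mulVf ?gt_eqF// => /le_trans; apply.
by rewrite ler_wpM2l.
Qed.

(** Together with [dbump_nd], an approximation of open sets from below by Lipschitz functions: it
    turns statements about integrals into statements about measures of open sets. *)
Lemma dbump_cvg G x : open G -> dbump G k x @[k --> \oo] --> (\1_G x : R).
Proof.
move=> oG; have [Gx|Gx] := pselect (G x).
  rewrite indicE mem_set//; have [k0 k0G] := dbump_in oG Gx.
  apply: cvg_near_cst; exists k0 => // k /= k0k; apply/eqP.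
  by rewrite eq_le dbump_le1 -k0G dbump_nd.
rewrite indicE memNset//.
by apply: cvg_near_cst; exists 0%N => // k _; rewrite dbump_out.
Qed.

Lemma bucont_dbump K G k : bucont K (@ndist R V) (dbump G k).
Proof.
split=> [|e e0].
  by exists 1 => x _; rewrite ger0_norm ?dbump_le1// dbump_ge0.
exists (e / k.+1%:R) => [|x y _ _ xy]; first by rewrite divr_gt0.
rewrite (le_trans (dbump_lip _ _ _ _))//.
rewrite (@le_trans _ _ (k.+1%:R * ndist x y))//.
  by rewrite ler_wpM2r ?normr_ge0// ler_nat.
by rewrite -ler_pdivlMl// mulrC ltW.
Qed.

End dbump.

(** * Uniform continuity and a Dini theorem on compact sets *)

Section compact_bucont.
Context {R : realType} {V : normedModType R}.
Variable K : set V.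
Hypothesis cK : compact K.

(** Heine-Cantor, through the near-covering form of compactness with the radius [dl] tending to 0
    from the right. It admits the test functions of [weak_cvg] to the class [bucont]. *)
Lemma within_continuous_bucont (f : V -> R) :
  {within K, continuous f} -> bucont K (@ndist R V) f.
Proof.
move=> cf; split.
  have /compact_bounded[M [_ fM]] := continuous_compact cf cK.
  by exists (M + 1) => x Kx; apply: (fM (M + 1)); [rewrite ltrDl|exists x].
move=> e e0; have e20 : 0 < e / 2 by rewrite divr_gt0.
have near_f x : K x -> \forall x' \near x & dl \near 0^'+,
    K x' -> forall y, K y -> ndist x' y < dl -> `|f x' - f y| <= e.
  move=> Kx; have /subspace_continuousP/(_ _ Kx)/cvgrPdist_lt/(_ _ e20) := cf.
  rewrite near_withinE => /nbhs_ballP[r /= r0 rK].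
  have r20 : 0 < r / 2 by rewrite divr_gt0.
  exists (ball x (r / 2), [set dl | dl < r / 2]) => /=.
    by split; [exact: nbhsx_ballx | exact: nbhs_right_lt].
  move=> [x' dl] /= []; rewrite -ball_normE/= => xx' dlr Kx' y Ky x'y.
  rewrite -(subrKA (f x)) [e]splitr (le_trans (ler_normD _ _))// lerD// ltW//.
    rewrite distrC; apply: rK => //; rewrite -ball_normE/= (lt_le_trans xx')//.
    by rewrite ler_pdivrMr// ler_peMr ?(ltW r0)// ler1n.
  apply: rK => //; rewrite -ball_normE/= [r]splitr -(subrKA x').
  by rewrite (le_lt_trans (ler_normD _ _))// ltrD// (lt_trans x'y).
have PF : ProperFilter (nbhs (0 : R)^'+) := at_right_proper_filter 0.
have nP := (compact_near_coveringP K).1 cK R 0^'+ _ PF near_f.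
have [dl [dlP dl0]] := @filter_ex _ _ PF _ (@filterI _ _ PF _ _ nP
  (nbhs_right_gt 0)).
by exists dl => // x y Kx; exact: dlP.
Qed.

(** One-sided Dini theorem: where [h k0] reaches 1, uniform continuity keeps it above [1 - e]
    nearby, monotonicity extends this to all later indices, and compactness provides one index for
    all points. *)
Lemma bucont_dini (h : nat -> V -> R) : (forall k, bucont K (@ndist R V) (h k))
  ->
  (forall x, K x -> {homo h ^~ x : k l / (k <= l)%N >-> k <= l}) ->
  (forall x, K x -> exists k, 1 <= h k x) ->
  forall e, 0 < e -> exists k, forall x, K x -> 1 - e <= h k x.
Proof.
move=> uh ndh h1 e e0.
have near_h x : K x -> \forall x' \near x & k \near \oo, K x' -> 1 - e <=
  h k x'.
  move=> Kx; have [k0 hk0] := h1 _ Kx; have [_ /(_ _ e0)[dl dl0 hdl]] := uh k0.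
  exists (ball x dl, [set k | (k0 <= k)%N]) => /=.
    by split; [exact: nbhsx_ballx | exact: nbhs_infty_ge].
  move=> [x' k] /= [] /[swap] k0k; rewrite -ball_normE/= => xx' Kx'.
  apply: le_trans (ndh _ Kx' _ _ k0k).
  have := hdl _ _ Kx Kx' xx'; rewrite ler_norml => /andP[_]; lra.
have nP := (compact_near_coveringP K).1 cK nat \oo _ (eventually_filter) near_h.
by have [k kP] := @filter_ex _ _ eventually_filter _ nP; exists k => x Kx;
  exact: kP.
Qed.

End compact_bucont.

(** * Borel measurability and integrability on spaces of matrices *)

Section matrix_borel.
Context {R : realType} {m n : nat}.
Local Notation X := 'M[R]_(m, n).

Lemma open_measurable_mx (G : set X) : open G -> measurable G.
Proof. by move=> oG; exact: sub_sigma_algebra. Qed.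

Lemma closed_measurable_mx (F : set X) : closed F -> measurable F.
Proof.
move=> cF; rewrite -[F]setCK; apply: measurableC; apply: open_measurable_mx.
exact: closed_openC.
Qed.

Lemma bucont_measurable (K : set X) (f : X -> R) : measurable K ->
  bucont K (@ndist R X) f -> measurable_fun K f.
Proof.
move=> mK [_ uf] _; apply: (measurability _ (RGenOInfty.measurableE R)) => //.
move=> _ [_ [a ->] <-].
(* Nothing is known of [f] off [K], so the superlevel set is written as the trace on [K] of an open
   set: the union of the balls centred in [K] on whose trace [f] exceeds [a]. *)
pose G := [set x | exists y r, [/\ K y, ndist x y < r,
  0 < r & forall z, K z -> ndist z y < r -> a < f z]].
suff -> : K `&` f @^-1` `]a, +oo[%classic = K `&` G.
  apply: measurableI => //; apply: open_measurable_mx.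
  rewrite openE => x [y [r [Ky xy r0 yr]]]; apply/nbhs_ballP.
  exists (r - ndist x y); first by rewrite /= subr_gt0.
  move=> z; rewrite -ball_normE/= => xz; exists y, r; split=> //.
  rewrite /ndist -(subrKA x) (le_lt_trans (ler_normD _ _))//.
  by rewrite -ltrBrDr distrC.
apply/seteqP; split=> x [Kx]; rewrite /= in_itv/= ?andbT.
  move=> afx; split=> //; have afx2 : 0 < (f x - a) / 2 by rewrite divr_gt0//
    subr_gt0.
  have [r r0 fr] := uf _ afx2; exists x, r; split=> //.
    by rewrite /ndist subrr normr0.
  move=> z Kz /(fr _ _ Kz Kx); rewrite ler_norml => /andP[+ _]; lra.
by move=> [y [r [Ky xy r0 ar]]]; split=> //; exact: ar.
Qed.

Lemma bounded_integrable (mu : probability X R) (K : set X) (f : X -> R) M :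
  measurable K -> measurable_fun K f -> (forall x, K x -> `|f x| <= M) ->
  mu.-integrable K (EFin \o f).
Proof.
move=> mK mf fM; apply: measurable_bounded_integrable => //.
  by rewrite (le_lt_trans (probability_le1 mu mK))// ltry.
exists M; split; first exact: num_real.
by move=> B MB x Kx /=; rewrite (le_trans (fM _ Kx))// ltW.
Qed.

Lemma bucont_integrable (mu : probability X R) (K : set X) (f : X -> R) :
  measurable K -> bucont K (@ndist R X) f -> mu.-integrable K (EFin \o f).
Proof.
move=> mK uf; have [[M fM] _] := uf.
by apply: (@bounded_integrable mu K f M mK _ fM); exact: bucont_measurable.
Qed.

End matrix_borel.

(** * Riesz representation on a compact set of matrices *)

Definition clip (R : realType) (t : R) : R := Num.max 0 (Num.min 1 t).

Section clip_theory.
Context {R : realType}.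
Implicit Types t : R.

Lemma clip_itv t : 0 <= clip t <= 1.
Proof. by rewrite /clip le_max lexx/= ge_max ler01 ge_min lexx. Qed.

Lemma clip_le0 t : t <= 0 -> clip t = 0.
Proof.
by move=> t0; rewrite /clip min_r ?max_l//; exact: le_trans t0 ler01.
Qed.

Lemma clip_ge1 t : 1 <= t -> clip t = 1.
Proof. by move=> t1; rewrite /clip min_l// max_r. Qed.

Lemma clip_id t : 0 <= t <= 1 -> clip t = t.
Proof. by move=> /andP[t0 t1]; rewrite /clip min_r// max_r. Qed.

Lemma clip_lip t u : `|clip t - clip u| <= `|t - u|.
Proof.
wlog tu : t u / u <= t.
  by move=> h; have [/h//|/ltW/h] := leP u t; rewrite distrC (distrC t).
rewrite [leRHS]ger0_norm ?subr_ge0// ler_norml.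
have cases (v : R) : [\/ v <= 0 /\ clip v = 0, 1 <= v /\ clip v = 1 |
    0 <= v <= 1 /\ clip v = v].
  have /orP[v0|v0] := le_total v 0; first exact: Or31 (conj v0 (clip_le0 v0)).
  have /orP[v1|v1] := le_total 1 v; first exact: Or32 (conj v1 (clip_ge1 v1)).
  have v01 : 0 <= v <= 1 by rewrite v0.
  exact: Or33 (conj v01 (clip_id v01)).
by case: (cases t) => -[? ->]; case: (cases u) => -[? ->]; lra.
Qed.

(** Layer-cake decomposition of [t] into layers of height 1: full layers below [t], one partial
    layer, empty ones above. The induction removes the bottom layer. *)
Lemma sum_clip N t : 0 <= t <= N%:R -> \sum_(j < N) clip (t - j%:R) = t.
Proof.
elim: N t => [|N IH] t /andP[t0 tN].
  by rewrite big_ord0; apply/eqP; rewrite eq_le t0 tN.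
rewrite big_ord_recl/= subr0; have [t1|t1] := leP 1 t.
  rewrite clip_ge1//; under eq_bigr do rewrite /bump/= natrD opprD addrA.
  rewrite IH ?subrKC//; apply/andP; split; first by rewrite subr_ge0.
  by rewrite lerBlDr natr1.
rewrite clip_id ?t0 ?ltW// big1 ?addr0// => j _; apply: clip_le0.
by rewrite subr_le0 (le_trans (ltW t1))// ler1n.
Qed.

End clip_theory.

Lemma integrable_sum_EFin d (T : measurableType d) (R : realType)
    (mu : {measure set T -> \bar R}) (D : set T) (I : Type) (r : seq I)
    (F : I -> T -> R) : measurable D ->
  (forall i, mu.-integrable D (EFin \o F i)) ->
  mu.-integrable D (EFin \o (fun x => \sum_(i <- r) F i x)).
Proof.
move=> mD iF; have := @integrable_sum _ _ _ mu D mD _ r xpredT (fun i =>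
  EFin \o F i).
move=> /(_ (fun i _ => iF i)); apply: eq_integrable => // x _ /=.
by rewrite -sumEFin.
Qed.

Lemma Rintegral_sum d (T : measurableType d) (R : realType)
    (mu : {measure set T -> \bar R}) (D : set T) (I : Type) (r : seq I)
    (F : I -> T -> R) : measurable D ->
  (forall i, mu.-integrable D (EFin \o F i)) ->
  \int[mu]_(x in D) (\sum_(i <- r) F i x) = \sum_(i <- r) \int[mu]_(x in D) F i
    x.
Proof.
move=> mD iF; elim: r => [|i r IH].
  rewrite big_nil; under eq_Rintegral do rewrite big_nil.
  by rewrite Rintegral_cst// mul0r.
rewrite big_cons -IH -RintegralD//; last exact: integrable_sum_EFin.
by apply: eq_Rintegral => x _; rewrite big_cons.
Qed.

Lemma compact_measurable_mx (R : realType) (m n : nat) (K : set 'M[R]_(m, n)) :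
  compact K -> measurable K.
Proof.
move=> cK; by apply: closed_measurable_mx; apply: compact_closed.
Qed.

Section riesz.
Context {R : realType} {m n : nat}.
Local Notation X := 'M[R]_(m, n).
Local Notation bc K := (bucont K (@ndist R X)).
Variables (K : set X) (Lam : (X -> R) -> R).
Hypothesis cK : compact K.
Hypothesis LamD : forall f g, bc K f -> bc K g ->
  Lam (fun x => f x + g x) = Lam f + Lam g.
Hypothesis LamZ : forall c f, bc K f -> Lam (fun x => c * f x) = c * Lam f.
Hypothesis le_Lam : forall f g, bc K f -> bc K g ->
  (forall x, K x -> f x <= g x) -> Lam f <= Lam g.
Hypothesis Lam1 : Lam (fun=> 1) = 1.

Let Lam_cst c : Lam (fun=> c) = c.
Proof.
rewrite -[RHS]mulr1 -Lam1 -LamZ; last exact: bucont_cst.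
by congr Lam; apply/funext => x; rewrite mulr1.
Qed.

Let LamB f g : bc K f -> bc K g -> Lam (fun x => f x - g x) = Lam f - Lam g.
Proof.
move=> uf ug; transitivity (Lam (fun x => f x + (-1) * g x)).
  by congr Lam; apply/funext => x; rewrite mulN1r.
by rewrite LamD ?LamZ ?mulN1r//; exact: bucontZ.
Qed.

Let Lam_sum (I : Type) (r : seq I) (F : I -> X -> R) : (forall i, bc K (F i)) ->
  Lam (fun x => \sum_(i <- r) F i x) = \sum_(i <- r) Lam (F i).
Proof.
move=> uF; elim: r => [|i r IH].
  by rewrite big_nil -[RHS]Lam_cst; congr Lam; apply/funext => x;
    rewrite big_nil.
rewrite big_cons -IH -LamD//; last exact: bucont_sum.
by congr Lam; apply/funext => x; rewrite big_cons.
Qed.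

(* Requiring the value [1] to be attained by the sequence, and not merely to be
   its supremum, makes [cover] stable under countable unions with no
   rescaling. *)
Let cover (A : set X) (v : R) := exists h : nat -> X -> R,
  [/\ forall k, bc K (h k), forall k x, K x -> 0 <= h k x,
      forall x, K x -> {homo h ^~ x : k l / (k <= l)%N >-> k <= l},
      forall x, A x -> K x -> exists k, 1 <= h k x
    & forall k, Lam (h k) <= v].

(** A real infimum suffices: costs are nonnegative, and the constant 1 covers every set at cost
    1. *)
Definition riesz_outer (A : set X) : \bar R := (inf [set v | cover A v])%:E.

Let Lam_ge0 f : bc K f -> (forall x, K x -> 0 <= f x) -> 0 <= Lam f.
Proof. by move=> uf f0; rewrite -(Lam_cst 0) le_Lam//; exact: bucont_cst. Qed.

Let cover_ge0 A v : cover A v -> 0 <= v.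
Proof.
by move=> [h [uh h0 _ _ hv]]; apply: le_trans (hv 0%N); apply: Lam_ge0 (h0 _).
Qed.

Let cover1 A : cover A 1.
Proof.
exists (fun _ _ => 1); split=> [k|k x _|x _ k l _|x _ _|k].
- exact: bucont_cst.
- exact: ler01.
- exact: lexx.
- by exists 0%N.
- by rewrite Lam1.
Qed.

Let cover_has_inf A : has_inf [set v | cover A v].
Proof.
by split; [exists 1; exact: cover1 | exists 0 => v; exact: cover_ge0].
Qed.

Let riesz_outer_le A v : cover A v -> (riesz_outer A <= v%:E)%E.
Proof. by move=> Av; rewrite lee_fin; apply: ge_inf => //;
  case: (cover_has_inf A). Qed.

Let riesz_outer_ge A (a : \bar R) : (forall v, cover A v -> (a <= v%:E)%E) ->
  (a <= riesz_outer A)%E.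
Proof.
move=> aA; case: a aA => [a| |] aA; last exact: leNye.
  by rewrite lee_fin; apply: lb_le_inf => [|v /aA//]; case: (cover_has_inf A).
by have := aA _ (cover1 A).
Qed.

Let riesz_outer_ge0 A : (0 <= riesz_outer A)%E.
Proof. by apply: riesz_outer_ge => v /cover_ge0; rewrite lee_fin. Qed.

Let cover_sub (A B : set X) v : A `&` K `<=` B -> cover B v -> cover A v.
Proof.
move=> AB [h [uh h0 ndh hB hv]]; exists h; split=> // x Ax Kx.
by apply: hB => //; exact: AB.
Qed.

Let le_riesz_outer A B : A `&` K `<=` B -> (riesz_outer A <= riesz_outer B)%E.
Proof.
by move=> AB; apply: riesz_outer_ge => v Bv; apply/riesz_outer_le/(cover_sub
  AB).
Qed.

Let riesz_outer0 : riesz_outer set0 = 0%E.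
Proof.
apply/eqP; rewrite eq_le riesz_outer_ge0 andbT; apply: riesz_outer_le.
exists (fun _ _ => 0); split=> [k|k x _|x _ k l _|//|k].
- exact: bucont_cst.
- exact: lexx.
- exact: lexx.
- by rewrite Lam_cst.
Qed.

Let riesz_outer_sigma_subadditive : sigma_subadditive riesz_outer.
Proof.
move=> A; apply/lee_addgt0Pr => e e0.
have near_inf k : exists v, cover (A k) v /\
    (v%:E <= riesz_outer (A k) + (e / (2 ^ k.+1)%:R)%:E)%E.
  have ek0 : 0 < e / (2 ^ k.+1)%:R by rewrite divr_gt0// ltr0n expn_gt0.
  have [v Av] := inf_adherent ek0 (cover_has_inf (A k)).
  by exists v; split=> //; rewrite -EFinD lee_fin ltW.
have /choice[v vP] := near_inf.
have hvP k := (vP k).1; have /choice[h hP] := hvP.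
apply: le_trans (epsilon_trick xpredT _ (ltW e0)) => //.
have v0 k : (0 <= (v k)%:E)%E by rewrite lee_fin (cover_ge0 (hvP k)).
apply: (@le_trans _ _ (\sum_(0 <= k <oo) (v k)%:E)%E); last first.
  by apply: lee_nneseries => k _ //; case: (vP k).
have := nneseries_ge0 (P := xpredT) (N := 0) (fun k _ _ => v0 k).
case E : (\sum_(0 <= k <oo) (v k)%:E)%E => [S| |]// _; last exact: leey.
(* The covers are added diagonally: the first [k.+1] of them, each at index [k]. A point covered by
   the [i]-th one at index [k] is covered by the sum at index [maxn i k]. *)
apply: riesz_outer_le; exists (fun k x => \sum_(0 <= i < k.+1) h i k x); split.
- by move=> k; apply: bucont_sum => i; case: (hP i).
- by move=> k x Kx; apply: sumr_ge0 => i _; have [_ h0 _ _ _] := hP i;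
    exact: h0.
- move=> x Kx k l kl; rewrite [leRHS](@big_cat_nat _ _ _ k.+1)//= ler_wpDr//.
    by apply: sumr_ge0 => i _; have [_ h0 _ _ _] := hP i; exact: h0.
  by apply: ler_sum => i _; have [_ _ ndh _ _] := hP i; exact: ndh.
- move=> x [i _ Aix] Kx; have [_ h0 ndh hA _] := hP i;
    have [k hk] := hA x Aix Kx.
  exists (maxn i k); rewrite (le_trans hk)// (le_trans (ndh _ Kx _ _ (leq_maxr
    i k)))//.
  have imem : i \in index_iota 0 (maxn i k).+1 by rewrite mem_index_iota ltnS
    leq_maxl.
  rewrite (bigD1_seq i imem (iota_uniq _ _))/= lerDl.
  by apply: sumr_ge0 => j _; have [_ hj0 _ _ _] := hP j; exact: hj0.
- move=> k; rewrite Lam_sum; last by move=> i; case: (hP i).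
  apply: (@le_trans _ _ (\sum_(0 <= i < k.+1) v i)).
    by apply: ler_sum => i _; case: (hP i).
  rewrite -lee_fin -E -sumEFin; apply: nneseries_lim_ge => i _ _; exact: v0.
Qed.

HB.instance Definition _ := isOuterMeasure.Build R X riesz_outer
  riesz_outer0 riesz_outer_ge0
  (fun A B AB => @le_riesz_outer A B (subset_trans (@subIsetl _ _ _) AB))
  riesz_outer_sigma_subadditive.

(** A cover [h] of [A] is divided by the bumps of [G]: [h k * dbump G k] covers the part in [G], and
    [h k * (1 - dbump G N)], with [N] fixed, the part outside. By additivity of [Lam] the two costs
    sum to at most [v + e]. *)
Let open_caratheodory (G : set X) : open G -> riesz_outer.-caratheodory G.
Proof.
move=> oG; apply: le_caratheodory_measurable => A; apply: riesz_outer_ge => v.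
move=> [h [uh h0 ndh hA hv]].
have h1 k x : K x -> 0 <= h k x * dbump G k x by move=> Kx;
  rewrite mulr_ge0 ?h0 ?dbump_ge0.
have uhG k l : bc K (fun x => h k x * dbump G l x).
  by apply: bucontM => //; exact: bucont_dbump.
have hG k l : Lam (fun x => h k x * dbump G l x) <= v.
  apply: le_trans (hv k); apply: le_Lam => // x Kx.
  by rewrite ler_piMr ?h0 ?dbump_le1.
pose u := sup (range (fun k => Lam (fun x => h k x * dbump G k x))).
have u_has_sup : has_sup (range (fun k => Lam (fun x => h k x * dbump G k x))).
  by split; [exists (Lam (fun x => h 0%N x * dbump G 0%N x)), 0%N|
             exists v => _ [k _ <-]].
have AG : cover (A `&` G) u.
  exists (fun k x => h k x * dbump G k x); split=> //.
  - move=> x Kx k l kl; rewrite ler_pM ?h0 ?dbump_ge0//; first exact: ndh.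
    exact: dbump_nd.
  - move=> x [Ax Gx] Kx; have [k hk] := hA _ Ax Kx;
      have [l bl] := dbump_in oG Gx.
    exists (maxn k l); rewrite -[1]mulr1 ler_pM//.
      by rewrite (le_trans hk)// ndh// leq_maxl.
    by rewrite -bl dbump_nd// leq_maxr.
  - by move=> k; apply: sup_ubound; [case: u_has_sup|exists k].
apply/lee_addgt0Pr => e e0.
(* The bump outside [G] is frozen at an [N] where the cost inside is within [e] of its supremum [u].
   The estimate below needs an index of at least [N]; smaller ones follow by monotonicity. *)
have [_ [N _ <-] uN] := sup_adherent e0 u_has_sup.
have AG' : cover (A `&` ~` G) (v - u + e).
  exists (fun k x => h k x * (1 - dbump G N x)); split.
  - move=> k; apply: bucontM => //; apply: bucontB; first exact: bucont_cst.
    exact: bucont_dbump.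
  - by move=> k x Kx; rewrite mulr_ge0 ?h0// subr_ge0 dbump_le1.
  - by move=> x Kx k l kl; rewrite ler_wpM2r ?ndh// subr_ge0 dbump_le1.
  - by move=> x [Ax Gx] Kx; have [k hk] := hA _ Ax Kx; exists k;
      rewrite dbump_out// subr0 mulr1.
  - have hN k : (N <= k)%N -> Lam (fun x => h k x * (1 - dbump G N x)) <=
      v - u + e.
      move=> Nk.
      have -> : (fun x => h k x * (1 - dbump G N x)) = (fun x =>
        h k x - h k x * dbump G N x).
        by apply/funext => x; rewrite mulrBr mulr1.
      rewrite LamB//.
      have : Lam (fun x => h N x * dbump G N x) <= Lam (fun x =>
        h k x * dbump G N x).
        by apply: le_Lam => // x Kx; rewrite ler_wpM2r ?dbump_ge0// ndh.
      by have := hv k; move: uN; rewrite -/u; lra.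
    move=> k; apply: le_trans (hN (maxn k N) (leq_maxr _ _)).
    have ub l : bc K (fun x => h l x * (1 - dbump G N x)).
      apply: bucontM => //; apply: bucontB; first exact: bucont_cst.
      exact: bucont_dbump.
    apply: le_Lam => // x Kx; rewrite ler_wpM2r ?subr_ge0 ?dbump_le1//.
    by rewrite ndh// leq_maxl.
apply: le_trans (leeD (riesz_outer_le AG) (riesz_outer_le AG')) _.
by rewrite -!EFinD lee_fin; lra.
Qed.

Let borel_caratheodory (A : set X) : measurable A ->
  riesz_outer.-caratheodory A.
Proof.
apply: smallest_sub; last by move=> G; exact: open_caratheodory.
exact: (@sigma_algebra_measurable _ (caratheodory_type riesz_outer)).
Qed.

Let riesz_outer_sigma_additive : semi_sigma_additive (riesz_outer : set X ->
  \bar R).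
Proof.
move=> F mF tF mUF.
apply: (@caratheodory_measure_sigma_additive _ _ riesz_outer) => //.
  by move=> i; exact: borel_caratheodory.
exact: borel_caratheodory.
Qed.

(** A second name for the same set function: [riesz_outer] carries the structure of an outer
    measure, this copy that of a measure on the Borel sets. *)
Definition riesz_measure (A : set X) : \bar R := riesz_outer A.

HB.instance Definition _ := isMeasure.Build _ X R riesz_measure
  riesz_outer0 riesz_outer_ge0 riesz_outer_sigma_additive.

(** Compactness of [K] prevents cheap covers: by Dini a cover of [K] exceeds [1 - e] on all of [K]
    at a single index, so its cost is at least [1 - e]. *)
Let riesz_measureK : riesz_measure K = 1%E.
Proof.
apply/eqP; rewrite eq_le riesz_outer_le//=; apply: riesz_outer_ge => v.
move=> [h [uh h0 ndh hA hv]]; rewrite lee_fin; apply/ler_addgt0Pr => e e0.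
have [k hk] := bucont_dini cK uh ndh (fun x Kx => hA x Kx Kx) e0.
rewrite -lerBlDr (le_trans _ (hv k))// -[leLHS]Lam_cst.
by apply: le_Lam => //; exact: bucont_cst.
Qed.

Let riesz_measureT : riesz_measure setT = 1%E.
Proof.
apply/eqP; rewrite eq_le -{2}riesz_measureK; apply/andP; split.
  by rewrite -riesz_measureK; apply: le_riesz_outer => x [].
exact: le_riesz_outer.
Qed.

HB.instance Definition _ :=
  Measure_isProbability.Build _ X R riesz_measure riesz_measureT.

Local Notation pi := (riesz_measure : probability X R).

Let mK : measurable K.
Proof. exact: compact_measurable_mx. Qed.

Let riesz_integral_cst (c : R) : \int[pi]_(_ in K) c = c.
Proof.
rewrite Rintegral_cst// -[RHS]mulr1; congr (_ * _).
by rewrite -[RHS]/(fine 1%E) -riesz_measureK.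
Qed.

(* [N * f] is the sum of its slices [F j], and the slice [F j] dominates the
   indicator of [E j], which in turn dominates the slice [F (j + 1)]. *)
Let riesz_integral_le f : bc K f -> (forall x, K x -> 0 <= f x <= 1) ->
  \int[pi]_(x in K) f x <= Lam f.
Proof.
move=> uf f01; apply/ler_addgt0Pr => e e0.
(* The bottom slice is dominated by no set [E j] and is bounded by 1; since [1 <= N * e], this loses
   at most [e] after division by [N]. *)
pose N' := Num.truncn e^-1; pose N := N'.+1.
have N0 : 0 < N%:R :> R by rewrite ltr0n.
have Ne : 1 <= N%:R * e.
  have : e^-1 < N%:R by exact: truncnS_gt.
  by move=> /ltW; rewrite -(ler_pM2r e0) mulVf ?gt_eqF.
pose F (j : nat) x := clip (N%:R * f x - j%:R).
have uF j : bc K (F j).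
  apply: (@bucont_le _ _ _ _ f _ N%:R) uf => x y _ _.
  rewrite (le_trans (clip_lip _ _))// opprB addrA subrK -mulrBr normrM.
  by rewrite ger0_norm ?ler0n.
have FE x : K x -> \sum_(j < N) F j x = N%:R * f x.
  move=> /f01/andP[f0 f1]; rewrite sum_clip// mulr_ge0 ?ler0n//=.
  by rewrite ler_piMr// ler0n.
pose E (j : nat) := K `&` f @^-1` `[j.+1%:R / N%:R, +oo[.
have mE j : measurable (E j) by apply: (bucont_measurable mK uf mK);
  exact: measurable_itv.
have iE j : pi.-integrable K (EFin \o \1_(E j)).
  apply: (@bounded_integrable _ _ _ pi K _ 1) => // x _.
  by rewrite indicE; case: (_ \in _); rewrite ?normr1 ?normr0.
have piE j : \int[pi]_(x in K) \1_(E j) x <= Lam (F j).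
  rewrite -lee_fin /Rintegral integral_indic// fineK; last first.
    exact: (fin_num_measure pi _ (measurableI _ _ (mE j) mK)).
  apply: riesz_outer_le; exists (fun=> F j); split=> [//|_ x _|x _ k l _|x|//].
  - by case/andP: (clip_itv (N%:R * f x - j%:R)).
  - exact: lexx.
  - case=> -[_ /=]; rewrite in_itv/= andbT ler_pdivrMr// => jf _ _.
    by exists 0%N; rewrite /F clip_ge1// lerBrDr addrC natr1 mulrC.
rewrite -(ler_pM2l N0) -RintegralZl//; last exact: bucont_integrable.
have le1 : \int[pi]_(x in K) (N%:R * f x) <=
    \int[pi]_(x in K) (1 + \sum_(j < N') \1_(E j) x).
  apply: le_Rintegral => //.
  - by apply: bucont_integrable => //; exact: bucontZ.
  - apply: (@bounded_integrable _ _ _ pi K _ (1 + \sum_(j < N') 1)) => //.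
      apply: measurable_funD => //; apply: measurable_sum => j.
      exact: measurable_indic.
    move=> x _; rewrite (le_trans (ler_normD _ _))// normr1 lerD2l.
    rewrite (le_trans (ler_norm_sum _ _ _))//; apply: ler_sum => j _.
    by rewrite indicE; case: (_ \in _); rewrite ?normr1 ?normr0.
  - move=> x Kx; rewrite -FE// /N big_ord_recl lerD//.
      by case/andP: (clip_itv (N%:R * f x - 0)).
    apply: ler_sum => j _; rewrite /F lift0.
    have [jf|jf] := leP j.+1%:R (N%:R * f x).
      rewrite indicE mem_set; first by case/andP:
        (clip_itv (N%:R * f x - j.+1%:R)).
      by split=> //=; rewrite in_itv/= andbT ler_pdivrMr// mulrC.
    by rewrite clip_le0 ?subr_le0 ?(ltW jf).
rewrite (le_trans le1)// RintegralD//; last 2 first.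
- by apply: bucont_integrable => //; exact: bucont_cst.
- exact: (@integrable_sum_EFin _ _ _ pi K 'I_N' _ (fun j => \1_(E j))).
rewrite riesz_integral_cst Rintegral_sum//.
apply: (@le_trans _ _ (N%:R * e + \sum_(j < N') Lam (F j))).
  by apply: lerD => //; apply: ler_sum => j _; exact: piE.
rewrite mulrDr addrC lerD2r -LamZ//.
have -> : Lam (fun x => N%:R * f x) = Lam (fun x => \sum_(j < N) F j x).
  apply/eqP; rewrite eq_le; apply/andP; split; apply: le_Lam => //;
    try (exact: bucontZ); try (exact: bucont_sum); by move=> x /FE ->.
rewrite Lam_sum// [leRHS]big_ord_recr/= lerDl; apply: Lam_ge0 => // x _.
by case/andP: (clip_itv (N%:R * f x - N'%:R)).
Qed.

(** The upper bound for [1 - f] is the lower bound for [f], because the integral and [Lam] give the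
    same value to constants. *)
Let riesz_integral01 f : bc K f -> (forall x, K x -> 0 <= f x <= 1) ->
  \int[pi]_(x in K) f x = Lam f.
Proof.
move=> uf f01; apply/eqP; rewrite eq_le riesz_integral_le//=.
have u1 : bc K (fun=> 1) by exact: bucont_cst.
have : \int[pi]_(x in K) (1 - f x) <= Lam (fun x => 1 - f x).
  apply: riesz_integral_le; first exact: bucontB.
  by move=> x /f01; rewrite subr_ge0 lerBlDr lerDl andbC.
rewrite LamB// Lam_cst RintegralB//; [|exact: bucont_integrable..].
by rewrite riesz_integral_cst; lra.
Qed.

Lemma riesz_representation : exists mu : probability X R, mu K = 1%E /\
  forall f, bc K f -> \int[mu]_(x in K) f x = Lam f.
Proof.
exists pi; split=> // f uf; have [[M fM] _] := uf.
pose B := `|M| + 1; have B0 : 0 < B by rewrite ltr_wpDl.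
have fB x : K x -> - B <= f x <= B.
  by move=> Kx; rewrite -ler_norml (le_trans (fM _ Kx))//
    (le_trans (ler_norm _))// lerDl.
pose g x := (2 * B)^-1 * (f x + B).
have B20 : 0 < 2 * B by rewrite mulr_gt0.
have u1 : bc K (fun=> B) by exact: bucont_cst.
have uD : bc K (fun x => f x + B) by exact: bucontD.
have : \int[pi]_(x in K) g x = Lam g.
  apply: riesz_integral01; first exact: bucontZ.
  move=> x /fB ?; rewrite mulr_ge0 ?invr_ge0 ?(ltW B20)//=; last lra.
  by rewrite ler_pdivrMl// mulr1; lra.
rewrite /g LamZ// RintegralZl//; last exact: bucont_integrable.
rewrite LamD// RintegralD//; [|exact: bucont_integrable..].
rewrite riesz_integral_cst Lam_cst => /mulfI.
by rewrite gt_eqF ?invr_gt0// => /(_ isT)/addIr.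
Qed.

End riesz.

(** * One step of a Markov chain with finitely many successors *)

Section probability_on_compact.
Context {R : realType} {m n : nat}.
Local Notation X := 'M[R]_(m, n).
Local Notation bc K := (bucont K (@ndist R X)).
Implicit Types (mu nu : probability X R) (K : set X).

Lemma bounded_cvg_Rintegral mu K (f_ : nat -> X -> R) (f : X -> R) M :
  measurable K -> (forall k, measurable_fun K (f_ k)) -> measurable_fun K f ->
  (forall k x, K x -> `|f_ k x| <= M) ->
  (forall x, K x -> f_ k x @[k --> \oo] --> f x) ->
  \int[mu]_(x in K) f_ k x @[k --> \oo] --> \int[mu]_(x in K) f x.
Proof.
move=> mK mf_ mf fM ff; apply: fine_cvg.
have fM' x : K x -> `|f x| <= M.
  move=> Kx; apply: (@cvgr_to_le _ _ _ _ _ _ _ (cvg_norm (ff x Kx))).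
  by apply: nearW => k; exact: fM.
have -> : (fine (\int[mu]_(x in K) (f x)%:E))%:E =
  (\int[mu]_(x in K) (f x)%:E)%E.
  by rewrite fineK//; apply: integrable_fin_num => //;
    exact: (@bounded_integrable _ _ _ mu K f M mK mf fM').
apply: (@dominated_cvg _ _ _ mu K mK _ _ (cst M%:E)) => //.
- by move=> k; exact/measurable_EFinP.
- by move=> x Kx; apply: cvg_EFin; [exact: nearW|exact: ff].
- apply: (@bounded_integrable _ _ _ mu K (cst M) `|M|) => //.
Qed.

Lemma probability_setI mu K A : measurable K -> measurable A -> mu K = 1%E ->
  mu (A `&` K) = mu A.
Proof.
move=> mK mA muK; rewrite [RHS](measureDI mu mA mK) [X in _ = (X + _)%E](_ :
  _ = 0%E) ?add0e//.
apply/eqP; rewrite eq_le measure_ge0 andbT.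
rewrite (@le_trans _ _ (mu (~` K)))//; last by rewrite probability_setC//
  muK subee.
apply: le_measure; rewrite ?inE; first exact: measurableD.
  exact: measurableC.
by move=> x [].
Qed.

Lemma Rintegral_indic_full mu K A : measurable K -> measurable A -> mu K =
  1%E ->
  \int[mu]_(x in K) \1_A x = fine (mu A).
Proof.
move=> mK mA muK; rewrite /Rintegral integral_indic//.
exact: (congr1 fine (probability_setI mK mA muK)).
Qed.

Lemma Rintegral_cst_full mu K (c : R) : measurable K -> mu K = 1%E ->
  \int[mu]_(_ in K) c = c.
Proof.
move=> mK muK; rewrite Rintegral_cst// -[RHS]mulr1; congr (_ * _).
exact: (congr1 fine muK).
Qed.

Lemma eq_probability_open mu nu : (forall G, open G -> mu G = nu G) ->
  forall A, measurable A -> mu A = nu A.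
Proof.
move=> munu; have cover : \bigcup_(k : nat) [set: X] = setT.
  by rewrite bigcup_const//; exists 0%N.
apply: (@measure_unique _ R X open (fun=> setT) erefl (@openI X) (fun=> openT)
  cover mu nu munu) => _.
by rewrite (le_lt_trans (probability_le1 mu _))// ltry.
Qed.

(** The functions [dbump G k] are admissible test functions, and by bounded convergence their
    integrals determine the measure of the open set [G]. *)
Lemma eq_probability_bucont mu nu K : measurable K -> mu K = 1%E -> nu K =
  1%E ->
  (forall f, bc K f -> \int[mu]_(x in K) f x = \int[nu]_(x in K) f x) ->
  forall A, measurable A -> mu A = nu A.
Proof.
move=> mK muK nuK munu; apply: eq_probability_open => G oG.
have mG := open_measurable_mx oG.
suff h : fine (mu G) = fine (nu G).
  have fin (la : probability X R) : la G \is a fin_num by exact: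
    fin_num_measure.
  by rewrite -(fineK (fin mu)) h (fineK (fin nu)).
rewrite -(Rintegral_indic_full mK mG muK) -(Rintegral_indic_full mK mG nuK).
have cvgG (la : probability X R) :
    \int[la]_(x in K) dbump G k x @[k --> \oo] --> \int[la]_(x in K) \1_G x.
  apply: (@bounded_cvg_Rintegral _ _ _ _ 1) => //.
  - by move=> k; apply: bucont_measurable => //; exact: bucont_dbump.
  - by move=> k x _; rewrite ger0_norm ?dbump_le1 ?dbump_ge0.
  - by move=> x _; exact: dbump_cvg.
have /cvg_lim <- // := cvgG mu; have /cvg_lim <- // := cvgG nu.
congr (lim (_ @ \oo)); apply/funext => k; apply: munu; exact: bucont_dbump.
Qed.

End probability_on_compact.

Section step_law.
Context {R : realType} {m n : nat} {I : finType}.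
Local Notation X := 'M[R]_(m, n).
Local Notation bc K := (bucont K (@ndist R X)).
Variables (w : I -> X -> X) (p : I -> X -> R) (K : set X).
Hypothesis cK : compact K.
Hypothesis wK : forall s x, K x -> K (w s x).
Hypothesis mw : forall s, measurable_fun setT (w s).
Hypothesis wbc : forall s f, bc K f -> bc K (f \o w s).
Hypothesis pbc : forall s, bc K (p s).
Hypothesis p_ge0 : forall s x, K x -> 0 <= p s x.
Hypothesis p_sum1 : forall x, K x -> \sum_s p s x = 1.

Lemma bucont_transfer f : bc K f -> bc K (transfer w p f).
Proof.
by move=> uf; apply: bucont_sum => s; apply: bucontM; [exact: pbc|exact: wbc].
Qed.

Lemma bucont_iter_transfer k f : bc K f -> bc K (iter k (transfer w p) f).
Proof. by move=> uf; elim: k => //= k; exact: bucont_transfer. Qed.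

Let mK : measurable K := compact_measurable_mx cK.

Variable mu : probability X R.
Hypothesis muK : mu K = 1%E.

(** For the AIMD data this is the successor clause of [chain_law], applied to a probability
    measure. *)
Definition step_law (C : set X) : \bar R :=
  (\int[mu]_(z in K) (\sum_s (p s z)%:E * \d_(w s z) C))%E.

Let step_kernelE z C :
  (\sum_s (p s z)%:E * \d_(w s z) C)%E = (transfer w p \1_C z)%:E.
Proof.
by rewrite /transfer -sumEFin; apply: eq_bigr => s _;
  rewrite diracE EFinM indicE.
Qed.

Let step_kernel_ge0 z C : K z -> (0 <= \sum_s (p s z)%:E * \d_(w s z) C)%E.
Proof. by move=> Kz; apply: sume_ge0 => s _; rewrite mule_ge0// lee_fin p_ge0.
  Qed.

Lemma measurable_transfer f : measurable_fun setT f ->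
  measurable_fun K (transfer w p f).
Proof.
move=> mf; apply: measurable_sum => s; apply: measurable_funM.
  exact: bucont_measurable.
by apply: (@measurable_funTS _ _ _ _ K); exact: measurableT_comp.
Qed.

Let measurable_step_kernel C : measurable C ->
  measurable_fun K (fun z => \sum_s (p s z)%:E * \d_(w s z) C)%E.
Proof.
move=> mC; have -> : (fun z => \sum_s (p s z)%:E * \d_(w s z) C)%E =
    EFin \o transfer w p \1_C by apply/funext => z; exact: step_kernelE.
apply/measurable_EFinP; apply: measurable_transfer; exact: measurable_indic.
Qed.

Let step_law0 : step_law set0 = 0%E.
Proof.
rewrite /step_law integral0_eq// => z Kz.
by rewrite big1// => s _; rewrite measure0 mule0.
Qed.

Let step_law_ge0 C : (0 <= step_law C)%E.
Proof. by apply: integral_ge0 => z; exact: step_kernel_ge0. Qed.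

Let step_law_sigma_additive : semi_sigma_additive step_law.
Proof.
move=> U mU tU mUU; rewrite [X in _ --> X](_ : _ =
  \int[mu]_(z in K) (\sum_(k <oo) \sum_s (p s z)%:E * \d_(w s z) (U k)))%E;
    last first.
  apply: eq_integral => z; rewrite inE => Kz.
  rewrite nneseries_sum; last by move=> *; rewrite mule_ge0// lee_fin p_ge0.
  apply: eq_bigr => s _; rewrite nneseriesZl//; congr (_ * _)%E.
  by apply/esym/cvg_lim => //; exact: measure_semi_sigma_additive.
apply/cvg_closeP; split.
  by apply: is_cvg_nneseries => k _ _; exact: step_law_ge0.
rewrite closeE// integral_nneseries//; first by move=> k;
  exact: measurable_step_kernel.
by move=> k z; exact: step_kernel_ge0.
Qed.

HB.instance Definition _ := isMeasure.Build _ X R step_law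
  step_law0 step_law_ge0 step_law_sigma_additive.

Let step_lawT : step_law setT = 1%E.
Proof.
transitivity (\int[mu]_(z in K) (cst 1 z))%E.
  apply: eq_integral => z; rewrite inE => Kz; rewrite step_kernelE.
  congr EFin; rewrite -(@transfer_cst _ _ _ w p K p_sum1 1 z Kz).
  by apply: eq_bigr => s _; rewrite indicT.
by rewrite integral_cst// mul1e.
Qed.

HB.instance Definition _ := Measure_isProbability.Build _ X R step_law
  step_lawT.

Local Notation nu := (step_law : probability X R).

Let step_law_full : nu K = 1%E.
Proof.
rewrite -step_lawT; apply: eq_integral => z; rewrite inE => Kz.
apply: eq_bigr => s _; rewrite !diracE.
by rewrite (mem_set (wK s Kz)) in_setT.
Qed.

Let transfer_norm_le1 f x : K x -> (forall y, K y -> 0 <= f y <= 1) ->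
  `|transfer w p f x| <= 1.
Proof.
move=> Kx /(@transfer_bnd _ _ _ w p K wK p_ge0 p_sum1 f 0 1 x Kx) /andP[f0 f1].
by rewrite ger0_norm.
Qed.

(** The duality between the step on measures and the step on functions. The right-hand side is a
    positive linear functional of [f], hence integration against some [la]; evaluating both measures
    on open sets through the bumps identifies [la] with [step_law]. *)
Lemma step_law_integral f : bc K f ->
  \int[nu]_(x in K) f x = \int[mu]_(x in K) transfer w p f x.
Proof.
pose Lam f := \int[mu]_(x in K) transfer w p f x.
have tI g : bc K g -> mu.-integrable K (EFin \o transfer w p g).
  by move=> ug; apply: bucont_integrable => //; exact: bucont_transfer.
have [] := @riesz_representation R m n K Lam cK.
- move=> g h ug uh; rewrite -RintegralD//; [|exact: tI..].
  by apply: eq_Rintegral => x _; exact: transferD.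
- move=> c g ug; rewrite -RintegralZl//; last exact: tI.
  by apply: eq_Rintegral => x _; exact: transferZ.
- move=> g h ug uh gh; apply: le_Rintegral => //; [exact: tI..|].
  by move=> x Kx; exact: (le_transfer wK p_ge0).
- transitivity (\int[mu]_(x in K) (cst 1 x)).
    apply: eq_Rintegral => x; rewrite inE => Kx.
    exact: (@transfer_cst _ _ _ w p K p_sum1 1 x Kx).
  exact: Rintegral_cst_full.
move=> la [laK laE] uf; rewrite -[RHS]/(Lam f) -laE//.
suff h A : measurable A -> nu A = la A.
  rewrite /Rintegral; congr fine; apply: eq_measure_integral => A mA _.
  exact: h.
move: A; apply: eq_probability_open => G oG.
have mG := open_measurable_mx oG.
rewrite -[la G]fineK ?fin_num_measure// -(Rintegral_indic_full mK mG laK).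
have -> : nu G = (\int[mu]_(z in K) transfer w p \1_G z)%:E.
  rewrite /= /step_law /Rintegral fineK; last first.
    apply: integrable_fin_num => //.
    apply: (@bounded_integrable _ _ _ mu K _ 1) => //.
      by apply: measurable_transfer; exact: measurable_indic.
    move=> x Kx; apply: transfer_norm_le1 => // y _.
    by rewrite indicE; case: (_ \in _); rewrite ?lexx ?ler01.
  by apply: eq_integral => z _; rewrite step_kernelE.
congr EFin.
have cvg1 : \int[la]_(x in K) dbump G k x @[k --> \oo] -->
  \int[la]_(x in K) \1_G x.
  apply: (@bounded_cvg_Rintegral _ _ _ _ _ _ _ 1) => //.
  - by move=> k; apply: bucont_measurable => //; exact: bucont_dbump.
  - by move=> k x _; rewrite ger0_norm ?dbump_le1 ?dbump_ge0.
  - by move=> x _; exact: dbump_cvg.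
have cvg2 : \int[mu]_(x in K) transfer w p (dbump G k) x @[k --> \oo] -->
    \int[mu]_(x in K) transfer w p \1_G x.
  apply: (@bounded_cvg_Rintegral _ _ _ _ _ _ _ 1) => //.
  - move=> k; apply: bucont_measurable => //; apply: bucont_transfer.
    exact: bucont_dbump.
  - by apply: measurable_transfer; exact: measurable_indic.
  - move=> k x Kx; apply: transfer_norm_le1 => // y _.
    by rewrite dbump_ge0 dbump_le1.
  - move=> x Kx; rewrite /transfer; apply: cvg_big => [|s _];
      first exact: add_continuous.
    apply: cvgMr.
    exact: dbump_cvg.
have /cvg_lim <- // := cvg1; have /cvg_lim <- // := cvg2.
congr (lim (_ @ \oo)); apply/funext => k.
by apply/esym/laE; exact: bucont_dbump.
Qed.

Lemma step_lawP : exists nu : probability X R, [/\ nu K = 1%E,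
  forall C, measurable C -> nu C = step_law C
  & forall f, bc K f ->
      \int[nu]_(x in K) f x = \int[mu]_(x in K) transfer w p f x].
Proof. by exists nu; split=> // f; exact: step_law_integral. Qed.

End step_law.

(** * The ergodic theorem along a trajectory *)

(** Between consecutive squares the index advances by at most [3 * j.+1], so [M] moves by O(j),
    which is negligible against the square itself. *)
Lemma cvg_ratio_of_squares (R : realType) (M : nat -> R) (b : R) :
  M 0%N = 0 -> (forall k, `|M k.+1 - M k| <= b) ->
  (M (j.+1 ^ 2)%N / (j.+1 ^ 2)%:R) @[j --> \oo] --> 0 ->
  (k%:R^-1 * M k) @[k --> \oo] --> 0.
Proof.
move=> M0 Mb Msq; have b0 : 0 <= b := le_trans (normr_ge0 _) (Mb 0%N).
have Mdist k l : `|M (k + l)%N - M k| <= l%:R * b.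
  elim: l => [|l IH]; first by rewrite addn0 subrr normr0 mul0r.
  rewrite addnS -(subrKA (M (k + l)%N)) (le_trans (ler_normD _ _))//.
  by rewrite -natr1 mulrDl mul1r addrC lerD.
apply/cvgr0Pnorm_le => e e0; have e20 : 0 < e / 2 by rewrite divr_gt0.
have /cvgr0Pnorm_le/(_ _ e20)[J _ hJ] := Msq.
(* For [j.+1 >= C] the displacement [3 * j.+1 * b] is at most [j.+1 ^ 2 * (e / 2)]. *)
pose C := 3 * b / (e / 2).
near=> k; have /= kbig : ((maxn J (Num.truncn C).+1).+1 ^ 2 <= k)%N by near: k;
  exact: nbhs_infty_ge.
have [j jk] : exists j, (j.+1 ^ 2 <= k < j.+2 ^ 2)%N.
  have ex : exists j, (j.+1 ^ 2 <= k)%N by exists (maxn J (Num.truncn C).+1).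
  have ub j : (j.+1 ^ 2 <= k)%N -> (j <= k)%N.
    by rewrite -mulnn; nia.
  case: (ex_maxnP ex ub) => j jk jmax; exists j; rewrite jk/= ltnNge.
  by apply/negP => /jmax; rewrite ltnn.
have /andP[jk1 jk2] := jk.
have Jj : (maxn J (Num.truncn C).+1 <= j)%N.
  rewrite leqNgt; apply/negP => jJ; move: jk2; rewrite ltnNge => /negP; apply.
  by apply: leq_trans kbig; rewrite leq_exp2r.
have k0 : 0 < k%:R :> R by rewrite ltr0n (leq_trans _ jk1)// expn_gt0.
have j0 : 0 < (j.+1 ^ 2)%:R :> R by rewrite ltr0n expn_gt0.
rewrite normrM ger0_norm ?invr_ge0 ?ler0n// ler_pdivrMl// [e]splitr mulrDr.
rewrite -[M k](subrK (M (j.+1 ^ 2)%N)) addrC (le_trans (ler_normD _ _))//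
  lerD//.
  have := hJ j (leq_trans (leq_maxl _ _) Jj); rewrite normrM.
  rewrite (@ger0_norm _ _^-1) ?invr_ge0 ?ler0n// ler_pdivrMr// => /le_trans;
    apply.
  by rewrite mulrC ler_wpM2r ?(ltW e20)// ler_nat.
rewrite -{1}(subnKC jk1) (le_trans (Mdist _ _))//.
have kj : ((k - j.+1 ^ 2) <= 3 * j.+1)%N by move: jk1 jk2; rewrite -!mulnn; nia.
apply: (@le_trans _ _ ((3 * j.+1)%:R * b)); first by rewrite ler_wpM2r//
  ler_nat.
apply: (@le_trans _ _ ((j.+1 ^ 2)%:R * (e / 2))); last first.
  by rewrite ler_wpM2r ?(ltW e20)// ler_nat.
have Cj : C <= j.+1%:R.
  have : C < (Num.truncn C).+1%:R by exact: truncnS_gt.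
  move=> /ltW/le_trans; apply; rewrite ler_nat.
  by rewrite (leq_trans _ (leqnSn _))// (leq_trans (leq_maxr _ _) Jj).
move: Cj; rewrite /C ler_pdivrMr// => Cj.
by have := ler_wpM2l (ler0n R j.+1) Cj; rewrite natrM natrX expr2; lra.
Unshelve. all: by end_near. Qed.

(** Telescoping, from 1/m^2 <= 2 (1/m - 1/(m+1)) for m >= 1. *)
Lemma sum_inv_sqr_le (R : realFieldType) n :
  \sum_(0 <= j < n) (j.+1 ^ 2)%:R^-1 <= 2 * (1 - n.+1%:R^-1) :> R.
Proof.
elim: n => [|n IH]; first by rewrite big_geq// invr1 subrr mulr0.
rewrite big_nat_recr//= (le_trans (lerD IH (lexx _)))// natrX.
have a0 : 0 < n.+1%:R :> R by rewrite ltr0n.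
have aE : n.+2%:R = n.+1%:R + 1 :> R by rewrite natr1.
rewrite aE; set a := n.+1%:R in a0 *; have a1 : 1 <= a by rewrite /a ler1n.
rewrite -subr_ge0 (_ : _ - _ = (a - 1) / (a ^+ 2 * (a + 1))).
  by rewrite divr_ge0 ?subr_ge0// mulr_ge0 ?exprn_ge0 ?addr_ge0 ?ltW.
by field; rewrite !gt_eqF// addr_gt0.
Qed.

(** * Expectations over the finitely many histories of the chain *)

Section chain_slln.
Context {d : measure_display} {Om : measurableType d} {R : realType}.
Context {X : choiceType} {I : finType}.
Variables (P : probability Om R) (w : I -> X -> X) (p : I -> X -> R).
Variables (K : set X) (z0 : X) (S : nat -> Om -> I) (z : nat -> Om -> X).

(** The events on which the history takes a given value form a finite partition, on whose members
    alone the law of the next choice has to be known. The current state is recovered as [last z0] of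
    the history. *)
Definition history (k : nat) (om : Om) : seq X :=
  [seq z j om | j <- iota 0 k.+1].

Hypothesis wK : forall s x, K x -> K (w s x).
Hypothesis p_ge0 : forall s x, K x -> 0 <= p s x.
Hypothesis p_sum1 : forall x, K x -> \sum_s p s x = 1.
Hypothesis Kz0 : K z0.
Hypothesis mS : forall k s, measurable (S k @^-1` [set s]).
Hypothesis zE0 : forall om, z 0%N om = z0.
Hypothesis zES : forall k om, z k.+1 om = w (S k om) (z k om).
Hypothesis mH : forall k a, measurable (history k @^-1` [set a]).
Hypothesis PS : forall k s a,
  P (history k @^-1` [set a] `&` S k @^-1` [set s]) =
  (\int[P]_(om in history k @^-1` [set a]) (p s (z k om))%:E)%E.

Let Kz k om : K (z k om).
Proof. by elim: k => [|k IH]; rewrite ?zE0// zES; exact: wK. Qed.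

Let historyS k om : history k.+1 om = rcons (history k om) (w (S k om) (z k
  om)).
Proof. by rewrite /history -addn1 iotaD map_cat/= cats1 add0n zES. Qed.

Let last_history k om : last z0 (history k om) = z k om.
Proof. by case: k => [|k]; rewrite ?historyS ?last_rcons ?zES. Qed.

Let size_history k om : size (history k om) = k.+1.
Proof. by rewrite size_map size_iota. Qed.

(** A list with possible repetitions, as different choices may lead to the same state; it is used
    through [undup]. *)
Fixpoint histories (k : nat) : seq (seq X) :=
  if k is k'.+1 then
    [seq rcons a (w s (last z0 a)) | a <- histories k', s <- enum I]
  else [:: [:: z0]].

Let mem_histories k om : history k om \in histories k.
Proof.
elim: k => [|k IH]; first by rewrite /history/= zE0 inE.
rewrite historyS -last_history; apply/allpairsPdep.
by exists (history k om), (S k om); split; rewrite ?mem_enum.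
Qed.

Let history_sum (G : seq X -> R) k om : G (history k om) =
  \sum_(a <- undup (histories k)) G a * \1_(history k @^-1` [set a]) om.
Proof.
rewrite (bigD1_seq (history k om)) ?undup_uniq ?mem_undup//=.
rewrite indicE mem_set// mulr1 big1 ?addr0// => a aH.
rewrite indicE memNset ?mulr0// => /= Ha.
by move: aH; rewrite -Ha eqxx.
Qed.

Lemma measurable_history (G : seq X -> R) k :
  measurable_fun setT (fun om => G (history k om)).
Proof.
under eq_fun do rewrite history_sum.
by apply: measurable_sum => a; apply: measurable_funM.
Qed.

(** The conditional law of the choice, given on each history by [PS], extends by linearity to every
    nonnegative function of the history. *)
Lemma history_choice (G : seq X -> R) k s : (forall a, 0 <= G a) ->
  (\int[P]_om (\1_(S k @^-1` [set s]) om * G (history k om))%:E =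
   \int[P]_om (p s (z k om) * G (history k om))%:E)%E.
Proof.
move=> G0.
have lhs om : (\1_(S k @^-1` [set s]) om * G (history k om))%:E =
  (\sum_(a <- undup (histories k))
    (G a)%:E * (\1_(history k @^-1` [set a] `&` S k @^-1` [set s]) om)%:E)%E.
  rewrite (history_sum G) mulr_sumr -sumEFin; apply: eq_bigr => a _.
  by rewrite indicI -EFinM/= mulrC -mulrA.
have rhs om : (p s (z k om) * G (history k om))%:E =
  (\sum_(a <- undup (histories k))
    (G a)%:E * (p s (last z0 a) * \1_(history k @^-1` [set a]) om)%:E)%E.
  rewrite (history_sum G) mulr_sumr -sumEFin; apply: eq_bigr => a _.
  rewrite -EFinM mulrCA; congr (_ * _)%:E.
  rewrite indicE; case: (boolP (_ \in _)); rewrite ?mulr0// inE => /= <-.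
  by rewrite last_history.
under eq_integral do rewrite lhs; under [RHS]eq_integral do rewrite rhs.
have p1_ge0 a om : 0 <= p s (last z0 a) * \1_(history k @^-1` [set a]) om.
  rewrite indicE; case: (boolP (_ \in _)); rewrite ?mulr0// inE => /= <-.
  by rewrite last_history mulr1 p_ge0.
have m1 a : measurable_fun setT
    (fun om => (\1_(history k @^-1` [set a] `&` S k @^-1` [set s]) om)%:E :
      \bar R).
  by apply/measurable_EFinP; apply: measurable_indic; exact: measurableI.
have m2 a : measurable_fun setT
    (fun om => (p s (last z0 a) * \1_(history k @^-1` [set a]) om)%:E).
  by apply/measurable_EFinP; apply: measurable_funM => //;
    exact: measurable_indic.
rewrite !ge0_integral_sum//; last 4 first.
- by move=> a; exact: measurable_funeM.
- by move=> a om _; rewrite mule_ge0 ?lee_fin.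
- by move=> a; exact: measurable_funeM.
- by move=> a om _; rewrite mule_ge0 ?lee_fin.
apply: eq_bigr => a _; rewrite !ge0_integralZl ?lee_fin//; last by move=> om _;
  rewrite lee_fin.
congr (_ * _)%E; rewrite integral_indic ?setIT//; last exact: measurableI.
apply: etrans (PS k s a) _; rewrite [LHS]integral_mkcond;
  apply: eq_integral => om _.
rewrite patchE indicE; case: ifPn; rewrite ?mulr0// inE => /= <-.
by rewrite last_history mulr1.
Qed.

(** The Markov property under expectation: splitting by the value of [S k] leaves, for each choice,
    a function of the history up to [k]. *)
Lemma history_step (H : seq X -> R) k : (forall a, 0 <= H a) ->
  (\int[P]_om (H (history k.+1 om))%:E =
   \int[P]_om (\sum_s p s (z k om) *
      H (rcons (history k om) (w s (z k om))))%:E)%E.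
Proof.
move=> H0; pose G s a := H (rcons a (w s (last z0 a))).
have lhs om : (H (history k.+1 om))%:E =
    (\sum_s (\1_(S k @^-1` [set s]) om * G s (history k om))%:E)%E.
  rewrite sumEFin (bigD1 (S k om))//= indicE mem_set//
    mul1r /G last_history -historyS.
  rewrite big1 ?addr0// => s sS; rewrite indicE memNset ?mul0r//= => Ss.
  by rewrite Ss eqxx in sS.
have rhs om : (\sum_s p s (z k om) * H (rcons (history k om) (w s (z k
  om))))%:E =
    (\sum_s (p s (z k om) * G s (history k om))%:E)%E.
  by rewrite sumEFin; congr EFin; apply: eq_bigr => s _;
    rewrite /G last_history.
under eq_integral do rewrite lhs; under [RHS]eq_integral do rewrite rhs.
rewrite !ge0_integral_sum//; last 4 first.
- move=> s; under eq_fun do rewrite -last_history.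
  by apply/measurable_EFinP; exact: (measurable_history (fun a =>
    p s (last z0 a) * G s a)).
- by move=> s om _; rewrite lee_fin mulr_ge0 ?p_ge0 ?H0.
- move=> s; apply/measurable_EFinP; apply: measurable_funM.
    exact: measurable_indic.
  exact: measurable_history.
- by move=> s om _; rewrite lee_fin mulr_ge0 ?H0.
by apply: eq_bigr => s _; apply: history_choice => a; exact: H0.
Qed.

(** * The martingale of a function of the state and its law of large numbers *)

Section martingale.
Variables (h : X -> R) (b : R).
Hypothesis hb : forall s x, K x -> `|h (w s x) - transfer w p h x| <= b.

Definition martingale (k : nat) (om : Om) : R :=
  \sum_(0 <= l < k) (h (z l.+1 om) - transfer w p h (z l om)).

(** The martingale as a function of the history alone, the form to which [history_step] applies. A
    history up to time [k] has [k.+1] entries, hence the predecessor of the size. *)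
Let Mpath (a : seq X) : R :=
  \sum_(0 <= l < (size a).-1) (h (nth z0 a l.+1) - transfer w p h (nth z0 a l)).

Let nth_history k om l : (l <= k)%N -> nth z0 (history k om) l = z l om.
Proof.
by move=> lk; rewrite (nth_map 0%N) ?size_iota ?ltnS// nth_iota.
Qed.

Let MpathE k om : Mpath (history k om) = martingale k om.
Proof.
rewrite /Mpath size_history succnK; apply: eq_big_nat => l /andP[_ lk].
by rewrite !nth_history// ltnW.
Qed.

Let Mpath_rcons k om x : Mpath (rcons (history k om) x) =
  martingale k om + (h x - transfer w p h (z k om)).
Proof.
rewrite /Mpath size_rcons size_history succnK big_nat_recr// -MpathE /Mpath.
rewrite size_history succnK; congr (_ + (h _ - transfer w p h _)).
- apply: eq_big_nat => l /andP[_ lk].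
  by rewrite !nth_rcons size_history !ltnS lk (ltnW lk).
- by rewrite nth_rcons size_history ltnn eqxx.
- by rewrite nth_rcons size_history ltnS leqnn nth_history.
Qed.

Lemma measurable_martingale k : measurable_fun setT (martingale k).
Proof.
have -> : martingale k = (fun om => Mpath (history k om)).
  by apply/funext => om; rewrite MpathE.
exact: measurable_history.
Qed.

(* Orthogonality of the increments: the cross term [2 M_k (M_(k+1) - M_k)] has
   zero conditional expectation. *)
Let martingale_step k om :
  \sum_s p s (z k om) * Mpath (rcons (history k om) (w s (z k om))) ^+ 2 <=
  martingale k om ^+ 2 + b ^+ 2.
Proof.
set x := z k om; set M := martingale k om.
pose D s := h (w s x) - transfer w p h x.
have pD : \sum_s p s x * D s = 0.
  transitivity (\sum_s (p s x * h (w s x) - p s x * transfer w p h x)).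
    by apply: eq_bigr => s _; rewrite mulrBr.
  by rewrite sumrB -mulr_suml p_sum1 ?mul1r ?subrr//; exact: Kz.
have -> : \sum_s p s x * Mpath (rcons (history k om) (w s x)) ^+ 2 =
    M ^+ 2 + \sum_s p s x * D s ^+ 2.
  transitivity (\sum_s (p s x * M ^+ 2 + 2 * M * (p s x * D s) + p s x * D s ^+
    2)).
    by apply: eq_bigr => s _; rewrite Mpath_rcons -/M -/(D s); ring.
  rewrite !big_split/= -mulr_suml p_sum1; last exact: Kz.
  by rewrite -mulr_sumr pD mulr0 addr0 mul1r.
rewrite lerD2l (@le_trans _ _ (\sum_s p s x * b ^+ 2))//.
  apply: ler_sum => s _; rewrite ler_wpM2l ?p_ge0//; first exact: Kz.
  rewrite -[D s ^+ 2]real_normK ?num_real// ler_sqr ?nnegrE//; last first.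
    exact: le_trans (normr_ge0 _) (hb s (Kz k om)).
  exact: hb (Kz k om).
by rewrite -mulr_suml p_sum1 ?mul1r//; exact: Kz.
Qed.

Lemma martingale_sqr_le k :
  (\int[P]_om (martingale k om ^+ 2)%:E <= (k%:R * b ^+ 2)%:E)%E.
Proof.
elim: k => [|k IH].
  rewrite mul0r integral0_eq// => om _.
  by rewrite /martingale big_geq// expr0n.
under eq_integral do rewrite -MpathE.
rewrite (@history_step (fun a => Mpath a ^+ 2)); last by move=> a;
  exact: sqr_ge0.
have mM2 : measurable_fun setT (fun om => martingale k om ^+ 2).
  exact: measurable_funX (measurable_martingale k).
apply: (@le_trans _ _ (\int[P]_om ((martingale k om ^+ 2)%:E + (b ^+ 2)%:E))%E).
  apply: ge0_le_integral => //.
  - move=> om _; rewrite lee_fin; apply: sumr_ge0 => s _.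
    by rewrite mulr_ge0 ?sqr_ge0// p_ge0//; exact: Kz.
  - apply/measurable_EFinP; apply: measurable_sum => s.
    have -> : (fun om => p s (z k om) * Mpath (rcons (history k om) (w s (z k
      om))) ^+ 2) =
        (fun om => (fun a => p s (last z0 a) * Mpath (rcons a (w s (last z0
          a))) ^+ 2)
                     (history k om)).
      by apply/funext => om; rewrite last_history.
    exact: (measurable_history
      (fun a => p s (last z0 a) * Mpath (rcons a (w s (last z0 a))) ^+ 2)).
  - by apply/measurable_EFinP; apply: measurable_funD.
  - by move=> om _; rewrite -EFinD lee_fin martingale_step.
rewrite ge0_integralD//; last 3 first.
- by move=> om _; rewrite lee_fin sqr_ge0.
- exact/measurable_EFinP.
- by move=> om _; rewrite lee_fin sqr_ge0.
rewrite integral_cst//= probability_setT mule1 -natr1 mulrDl mul1r EFinD.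
exact: leeD.
Qed.

(** At time m^2 the second moment is at most m^2 b^2, so that of the ratio is at most b^2 / m^2,
    which is summable. The series of the squared ratios [Y j] is then integrable, hence finite
    almost surely, and its terms tend to 0. *)
Lemma martingale_slln :
  {ae P, forall om, k%:R^-1 * martingale k om @[k --> \oo] --> 0}.
Proof.
pose Y j om : \bar R := ((martingale (j.+1 ^ 2) om / (j.+1 ^ 2)%:R) ^+ 2)%:E.
have Y0 j om : (0 <= Y j om)%E by rewrite lee_fin sqr_ge0.
have mY j : measurable_fun setT (Y j).
  apply/measurable_EFinP; apply: measurable_funX.
  apply: measurable_funM => //; exact: measurable_martingale.
have intY j : (\int[P]_om Y j om <= (b ^+ 2 / (j.+1 ^ 2)%:R)%:E)%E.
  have j0 : 0 < (j.+1 ^ 2)%:R :> R by rewrite ltr0n expn_gt0.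
  rewrite /Y; under eq_integral do rewrite exprMn mulrC EFinM.
  rewrite ge0_integralZl ?lee_fin ?sqr_ge0//; last 2 first.
  - apply/measurable_EFinP; apply: measurable_funX;
      exact: measurable_martingale.
  - by move=> om _; rewrite lee_fin sqr_ge0.
  apply: le_trans (lee_wpmul2l _ (martingale_sqr_le _)) _.
    by rewrite lee_fin sqr_ge0.
  rewrite -EFinM lee_fin expr2 -mulrA (mulrA _^-1 _%:R) mulVf ?gt_eqF//.
  by rewrite mul1r mulrC.
have sumY : (\int[P]_om (\sum_(j <oo) Y j om) < +oo)%E.
  rewrite integral_nneseries//.
  apply: (@le_lt_trans _ _ (b ^+ 2 * 2)%:E); last exact: ltry.
  apply: lime_le; first by apply: is_cvg_nneseries => j _ _;
    exact: integral_ge0.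
  apply: nearW => n.
  apply: (@le_trans _ _ (\sum_(0 <= j < n) (b ^+ 2 / (j.+1 ^ 2)%:R)%:E)%E).
    by apply: lee_sum => j _.
  rewrite sumEFin lee_fin -mulr_sumr ler_wpM2l ?sqr_ge0//.
  rewrite (le_trans (sum_inv_sqr_le R n))// ler_piMr// gerBl invr_ge0//.
have : P.-integrable setT (fun om => \sum_(j <oo) Y j om)%E.
  apply/integrableP; split.
    by apply: ge0_emeasurable_sum => // j _; exact: mY.
  by under eq_integral => om _ do rewrite gee0_abs ?nneseries_ge0//.
move=> /(integrable_ae measurableT); apply: filterS => om /(_ Logic.I) Yfin.
have Ylt : (\sum_(j <oo) Y j om < +oo)%E by rewrite -ge0_fin_numE//
  nneseries_ge0.
apply: (@cvg_ratio_of_squares _ _ b).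
- by rewrite /martingale big_geq.
- move=> k; rewrite /martingale big_nat_recr//= addrAC subrr add0r zES.
  exact: hb (Kz k om).
(* The term [Y N] is at most the tail of the series from [N] on, which is eventually below
   [e ^+ 2]. *)
apply/cvgr0Pnorm_le => e e0.
have /fine_cvgP[_ /cvgr0Pnorm_le/(_ (e ^+ 2))] :=
  nneseries_tail_cvg Ylt (fun j _ => Y0 j om).
move=> /(_ (exprn_gt0 _ e0)); apply: filter_app; near=> N => /=.
rewrite (@nneseries_split _ _ N 1)// addn1 big_nat1 => hN.
have tail0 : (0 <= \sum_(N.+1 <= j <oo) Y j om)%E by exact: nneseries_ge0.
have tailfin : (\sum_(N.+1 <= j <oo) Y j om < +oo)%E.
  apply: le_lt_trans Ylt; rewrite [leRHS](@nneseries_split _ _ 0 N.+1)//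
    leeDr//.
  by rewrite add0n sume_ge0.
have YNfin : (Y N om < +oo)%E by exact: ltry.
move: hN; rewrite fineD ?ge0_fin_numE// ger0_norm ?addr_ge0 ?fine_ge0// => hN.
have : (martingale (N.+1 ^ 2) om / (N.+1 ^ 2)%:R) ^+ 2 <= e ^+ 2.
  by apply: le_trans hN; rewrite lerDl fine_ge0.
by rewrite -[_ ^+ 2 as X in X <= _]real_normK ?num_real// ler_sqr ?nnegrE// ltW.
Unshelve. all: by end_near. Qed.

End martingale.

(** * Time averages along a trajectory *)

Section ergodic.
Variables (f : X -> R) (A La : R).
Hypothesis fA : forall x, K x -> `|f x| <= A.

(* Approximate solution of Poisson's equation, see [potentialE]. *)
Definition potential (N : nat) (x : X) : R :=
  \sum_(0 <= i < N) iter i (transfer w p) f x.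

Lemma potentialE N x :
  potential N x - transfer w p (potential N) x =
    f x - iter N (transfer w p) f x.
Proof.
have -> : transfer w p (potential N) x = \sum_(0 <=
  i < N) iter i.+1 (transfer w p) f x.
  rewrite /transfer /= exchange_big/=; apply: eq_bigr => s _.
  by rewrite mulr_sumr.
rewrite -sumrB; transitivity (- \sum_(0 <= i < N)
    (iter i.+1 (transfer w p) f x - iter i (transfer w p) f x)).
  by rewrite -sumrN; apply: eq_bigr => i _; rewrite opprB.
by rewrite (telescope_sumr (fun i => iter i (transfer w p) f x))// opprB.
Qed.

Let potential_bnd N x : K x -> - (N%:R * A) <= potential N x <= N%:R * A.
Proof.
move=> Kx; rewrite -ler_norml (le_trans (ler_norm_sum _ _ _))//.
rewrite (@le_trans _ _ (\sum_(0 <= i < N) A))//;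
  last by rewrite sumr_const_nat subn0 mulr_natl.
apply: ler_sum => i _; rewrite ler_norml.
by apply: (iter_transfer_bnd wK p_ge0 p_sum1) => // y Ky; rewrite -ler_norml fA.
Qed.

Let potential_diff N s x : K x ->
  `|potential N (w s x) - transfer w p (potential N) x| <= 2 * N%:R * A.
Proof.
move=> Kx; have /andP[h1 h2] := potential_bnd N (wK s Kx).
have /andP[h3 h4] := transfer_bnd wK p_ge0 p_sum1 Kx (@potential_bnd N).
by rewrite ler_norml; lra.
Qed.

Hypothesis fLa : forall e, 0 < e -> exists N, forall x, K x ->
  `|iter N (transfer w p) f x - La| <= e.

Lemma chain_ergodic : {ae P, forall om,
  k%:R^-1 * \sum_(0 <= l < k.+1) f (z l om) @[k --> \oo] --> La}.
Proof.
have q0 q : 0 < q.+1%:R^-1 :> R by rewrite invr_gt0 ltr0n.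
(* The accuracies are restricted to the countably many [q.+1%:R^-1], so that a single null set
   serves all the martingales. *)
have /choice[N NP] := fun q => fLa (q0 q).
have := ae_foralln (fun q => martingale_slln (fun s x Kx =>
  @potential_diff (N q) s x Kx)).
apply: filterS => om slln; apply/cvgrPdist_le => e e0.
have e40 : 0 < e / 4 by rewrite divr_gt0.
pose q := Num.truncn (e / 4)^-1.
have qe : q.+1%:R^-1 <= e / 4.
  rewrite -[leRHS]invrK lef_pV2 ?posrE ?invr_gt0 ?ltr0n//.
  by apply/ltW; exact: truncnS_gt.
have Msmall := slln q; move/cvgr0Pnorm_le/(_ _ e40) : Msmall => Msmall.
have A0 : 0 <= A := le_trans (normr_ge0 _) (fA Kz0).
pose B := A + 2 * (N q)%:R * A.
have B0 : 0 <= B by rewrite addr_ge0// !mulr_ge0 ?ler0n.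
near=> k.
have k0 : 0 < k%:R :> R by rewrite ltr0n; near: k; exact: nbhs_infty_gt.
(* The sum has [k.+1] terms but is divided by [k]: the last one, [f (z k om)], joins the telescoped
   potentials in a boundary term bounded by [B]. Boundary term, iterates and martingale each cost at
   most [e / 4]. *)
have decomp : \sum_(0 <= l < k.+1) f (z l om) =
    (f (z k om) + potential (N q) (z 0%N om) - potential (N q) (z k om))
    + \sum_(0 <= l < k) iter (N q) (transfer w p) f (z l om)
    + martingale (potential (N q)) k om.
  have fE l : f (z l om) =
      (potential (N q) (z l om) - potential (N q) (z l.+1 om)) +
      iter (N q) (transfer w p) f (z l om) +
      (potential (N q) (z l.+1 om) - transfer w p (potential (N q)) (z l om)).
    by have := potentialE (N q) (z l om); lra.
  rewrite big_nat_recr//= (eq_bigr _ (fun l _ => fE l)) big_split big_split/=.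
  have -> : \sum_(0 <= l < k) (potential (N q) (z l om) - potential (N q) (z
    l.+1 om)) =
      potential (N q) (z 0%N om) - potential (N q) (z k om).
    rewrite -[RHS]opprB -(telescope_sumr (fun l =>
      potential (N q) (z l om)) (leq0n k)).
    by rewrite -sumrN; apply: eq_bigr => l _; rewrite opprB.
  by rewrite /martingale; ring.
set T1 := (X in X + _ + _) in decomp; set T2 := (X in _ + X + _) in decomp.
have T1B : `|T1| <= k%:R * (e / 4).
  apply: (@le_trans _ _ B).
    have := fA (Kz k om); rewrite ler_norml => /andP[? ?].
    have /andP[? ?] := potential_bnd (N q) (Kz k om).
    have /andP[? ?] := potential_bnd (N q) (Kz 0 om).
    by rewrite /T1 /B ler_norml; lra.
  by rewrite -ler_pdivrMr//; near: k; exact: nbhs_infty_ger.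
have T2B : `|T2 - k%:R * La| <= k%:R * (e / 4).
  have -> : k%:R * La = \sum_(0 <= l < k) La by rewrite sumr_const_nat subn0
    mulr_natl.
  rewrite /T2 -sumrB (le_trans (ler_norm_sum _ _ _))//.
  have -> : k%:R * (e / 4) = \sum_(0 <= l < k) (e / 4) by rewrite
    sumr_const_nat subn0 mulr_natl.
  by apply: ler_sum => l _; rewrite (le_trans (NP q _ (Kz l om))).
have T3B : `|martingale (potential (N q)) k om| <= k%:R * (e / 4).
  have : `|k%:R^-1 * martingale (potential (N q)) k om| <= e / 4 by near: k.
  by rewrite normrM ger0_norm ?invr_ge0 ?ler0n// ler_pdivrMl.
have : `|k%:R * La - \sum_(0 <= l < k.+1) f (z l om)| <= k%:R * e.
  rewrite decomp; move: T1B T2B T3B; rewrite !ler_norml.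
  by move=> /andP[? ?] /andP[? ?] /andP[? ?]; lra.
rewrite [X in _ -> `|X| <= _](_ : _ = k%:R^-1 *
  (k%:R * La - \sum_(0 <= l < k.+1) f (z l om))); last first.
  by rewrite mulrBr mulKf// gt_eqF.
by rewrite normrM (ger0_norm (ltW _)) ?invr_gt0// ler_pdivrMl.
Unshelve. all: by end_near. Qed.

End ergodic.

End chain_slln.

(** * The AIMD chain *)

Section eq_integral.
Import HBNNSimple.

(** Here [m1] and [m2] are bare set functions, as [chain_law] is: the integral is built from simple
    functions, whose integrals evaluate the set function on measurable sets only. *)
Lemma eq_integral_measurable d (T : measurableType d) (R : realType)
    (m1 m2 : set T -> \bar R) (D : set T) (f : T -> \bar R) :
  (forall A, measurable A -> m1 A = m2 A) ->
  (\int[m1]_(x in D) f x = \int[m2]_(x in D) f x)%E.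
Proof.
move=> m12; have sE (h : {nnsfun T >-> R}) : sintegral m1 h = sintegral m2 h.
  by rewrite /sintegral; apply: eq_fsbigr => x _; rewrite m12.
rewrite /integral; congr (ereal_sup _ - ereal_sup _)%E;
  by apply: eq_imagel => h _; exact: sE.
Qed.

End eq_integral.

(** One factor is exchanged at a time, all the others being at most 1. *)
Lemma prod_dist_le (R : realDomainType) (I : Type) (r : seq I) (a b : I -> R) :
  (forall i, 0 <= a i <= 1) -> (forall i, 0 <= b i <= 1) ->
  `|\prod_(i <- r) a i - \prod_(i <- r) b i| <= \sum_(i <- r) `|a i - b i|.
Proof.
move=> a01 b01; elim: r => [|i r IH]; first by rewrite !big_nil subrr normr0.
rewrite !big_cons.
set A := \prod_(j <- r) a j; set B := \prod_(j <- r) b j.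
have -> : a i * A - b i * B = (a i - b i) * A + b i * (A - B) by ring.
rewrite (le_trans (ler_normD _ _))// !normrM lerD//.
  rewrite ler_piMr// ger0_norm ?prodr_ge0//.
    by apply: prodr_ile1 => j _; exact: a01.
  by move=> j _; case/andP: (a01 j).
have /andP[bi0 bi1] := b01 i.
by rewrite (le_trans _ IH)// ger0_norm// ler_piMl.
Qed.

Section lipschitz_mx.
Context {R : realType}.

Lemma lipschitz_continuous (V W : normedModType R) (f : V -> W) C :
  (forall x y, `|f x - f y| <= C * `|x - y|) -> continuous f.
Proof.
move=> fC x; apply/cvgrPdist_le => e e0.
have C0 : 0 < `|C| + 1 by rewrite ltr_wpDl.
near=> y; apply: le_trans (fC _ _) _.
apply: (@le_trans _ _ ((`|C| + 1) * `|x - y|)).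
  by rewrite ler_wpM2r// (le_trans (ler_norm C))// lerDl.
rewrite -ler_pdivlMl//; near: y.
by apply: cvgr_dist_le; rewrite // mulr_gt0// invr_gt0.
Unshelve. all: by end_near. Qed.

Lemma continuous_measurable_mx (m n m' n' : nat) (f : 'M[R]_(m, n) ->
  'M[R]_(m', n')) :
  continuous f -> measurable_fun setT f.
Proof.
move=> cf; apply: (@measurability _ _ _ _ setT f open erefl).
move=> _ [U oU <-]; rewrite setTI; apply: open_measurable_mx.
by move/continuousP : cf => /(_ _ oU).
Qed.

Lemma ler_mx_normP (m n : nat) (x : 'M[R]_(m, n)) e :
  0 <= e -> (forall i j, `|x i j| <= e) -> `|x| <= e.
Proof.
by move=> e0 xe; rewrite [`|x|]mx_normrE; apply/bigmax_leP; split=> // -[i j] _.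
Qed.

Lemma ler_mx_coord (m n : nat) (x : 'M[R]_(m, n)) i j : `|x i j| <= `|x|.
Proof.
rewrite [`|x|]mx_normrE; exact: (le_bigmax _ (fun ij => `|x ij.1 ij.2|) (i, j)).
Qed.

Lemma bucont_dist (X : Type) (K : set X) (d d' : X -> X -> R) C f :
  (forall x y, 0 <= d x y) ->
  (forall x y, K x -> K y -> d' x y <= C * d x y) ->
  bucont K d' f -> bucont K d f.
Proof.
move=> d0 dd' [fb fu]; split=> // e e0; have [a a0 fa] := fu _ e0.
have C0 : 0 < `|C| + 1 by rewrite ltr_wpDl.
exists (a / (`|C| + 1)) => [|x y Kx Ky xy]; first by rewrite divr_gt0.
apply: fa => //; apply: le_lt_trans (dd' _ _ Kx Ky) _.
apply: (@le_lt_trans _ _ ((`|C| + 1) * d x y)).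
  by rewrite ler_wpM2r// (le_trans (ler_norm C))// lerDl.
by rewrite -ltr_pdivlMl// mulrC.
Qed.

End lipschitz_mx.

(** * Compactness of the product of simplices *)

Section simplexT_theory.
Context {R : realType} {n T : nat}.
Local Notation X := 'M[R]_(n, T.+1).
Local Notation K := (@simplexT R n T).

Lemma simplexTP (z : X) :
  K z <-> (forall i j, 0 <= z i j) /\ (forall j, \sum_i z i j = 1).
Proof.
split=> [Kz|[z0 z1] j]; last first.
  split=> [i|]; first by rewrite mxE.
  by under eq_bigr do rewrite mxE; exact: z1.
split=> [i j|j]; have [zj0 zj1] := Kz j.
  by have := zj0 i; rewrite mxE.
by rewrite -zj1; apply: eq_bigr => i _; rewrite mxE.
Qed.

Lemma simplexT_itv (z : X) i j : K z -> z i j \in `[0, 1].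
Proof.
move=> /simplexTP[z0 z1]; rewrite in_itv/= z0/= -(z1 j) (bigD1 i)//= lerDl.
by apply: sumr_ge0 => k _.
Qed.

(** Closed bounded sets of row vectors are compact, and [vec_mx], which is 1-Lipschitz, carries this
    over to matrices. *)
Lemma compact_simplexT : compact K.
Proof.
pose A := [set v : 'rV[R]_(n * T.+1) | K (vec_mx v)].
have -> : K = vec_mx @` A.
  apply/seteqP; split=> [z Kz|_ [v Av <-]//].
  by exists (mxvec z); rewrite /A/= ?mxvecK.
apply: continuous_compact.
  apply: continuous_subspaceT.
  apply: (@lipschitz_continuous _ _ _ _ 1) => u v; rewrite mul1r.
  apply: ler_mx_normP => // i j; rewrite !mxE.
  by have := ler_mx_coord (u - v) 0 (mxvec_index i j); rewrite !mxE.
apply: bounded_closed_compact.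
  exists 1; split=> // B B1 v Av; apply: ler_mx_normP => [|i j].
    by rewrite (le_trans ler01)// ltW.
  rewrite ord1; case/mxvec_indexP: j => j k.
  have := simplexT_itv j k Av; rewrite mxE in_itv/= => /andP[v0 v1].
  by rewrite ger0_norm// (le_trans v1)// ltW.
pose c i j (v : 'rV[R]_(n * T.+1)) := v 0 (mxvec_index i j).
have cc i j : continuous (c i j) by exact: coord_continuous.
have -> : A = (\bigcap_ij (c ij.1 ij.2 @^-1` [set x | 0 <= x])) `&`
    (\bigcap_j ((fun v => \sum_i c i j v) @^-1` [set 1])).
  apply/seteqP; split=> [v /simplexTP[v0 v1]|v [v0 v1]].
    split=> [[i j] _|j _] /=; first by have := v0 i j; rewrite mxE.
    by rewrite -(v1 j); apply: eq_bigr => i _; rewrite mxE.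
  apply/simplexTP; split=> [i j|j]; first by rewrite mxE; exact: (v0 (i, j)).
  by rewrite -[RHS](v1 j)//; apply: eq_bigr => i _; rewrite mxE.
apply: closedI; apply: closed_bigI => i _.
  apply: preimage_closed; first by move=> x _; exact: cc.
  exact: closed_ge.
apply: preimage_closed; last exact: closed_eq.
move=> x _; apply: cvg_big; first exact: add_continuous.
  exact: (@nbhs_filter _ x).
by move=> k _; exact: (cc k i x).
Qed.

End simplexT_theory.

(** * Nonexpansiveness and contraction of the averaged AIMD maps *)

Section aimd.
Context {R : realType} {n T : nat}.
Local Notation X := 'M[R]_(n, T.+1).
Local Notation K := (@simplexT R n T).
Variables (alpha beta : 'cV[R]_n) (c : R).
Hypothesis alpha_simplex : simplex alpha.
Hypothesis beta_ge0 : forall i, 0 <= beta i 0.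
Hypothesis beta_le : forall i, beta i 0 <= c.
Hypothesis c_itv : 0 < c < 1.
Implicit Types (S : {set 'I_n}) (x y z : X) (u : 'cV[R]_n).

Let tbeta_itv S i : 0 <= tbeta beta S i 0 <= 1.
Proof.
rewrite mxE; case: ifP; rewrite ?ler01 ?lexx//
  beta_ge0 (le_trans (beta_le i))//.
by case/andP: c_itv => _ /ltW.
Qed.

Let aimd_mulE S u i : (aimd_mx alpha beta S *m u) i 0 =
  tbeta beta S i 0 * u i 0 + alpha i 0 * \sum_j (1 - tbeta beta S j 0) * u j 0.
Proof.
rewrite /aimd_mx mulmxDl mxE mul_diag_mx mxE mxE; congr (_ + _).
rewrite -mulmxA mxE big_ord1 mxE; congr (_ * _).
by apply: eq_bigr => j _; rewrite !mxE.
Qed.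

Lemma aimd_sum S u : \sum_i (aimd_mx alpha beta S *m u) i 0 = \sum_i u i 0.
Proof.
under eq_bigr do rewrite aimd_mulE.
rewrite big_split/= -mulr_suml (alpha_simplex.2) mul1r -big_split/=.
by apply: eq_bigr => i _; rewrite mulrBl mul1r addrC subrK.
Qed.

Lemma aimd_ge0 S u i : (forall i, 0 <= u i 0) ->
  0 <= (aimd_mx alpha beta S *m u) i 0.
Proof.
move=> u0; rewrite aimd_mulE addr_ge0// mulr_ge0//.
- by case/andP: (tbeta_itv S i).
- exact: alpha_simplex.1.
- apply: sumr_ge0 => j _; rewrite mulr_ge0// subr_ge0.
  by case/andP: (tbeta_itv S j).
Qed.

(* Removing [b *: (alpha *m e^T)], which kills vectors of zero sum, leaves a
   nonnegative matrix whose columns sum to [1 - b]. *)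
Let aimd_norm1 S u b : (forall i, b <= 1 - tbeta beta S i 0) ->
  b * \sum_i u i 0 = 0 ->
  \sum_i `|(aimd_mx alpha beta S *m u) i 0| <= (1 - b) * \sum_i `|u i 0|.
Proof.
move=> bS bu.
have E i : (aimd_mx alpha beta S *m u) i 0 =
  tbeta beta S i 0 * u i 0 + alpha i 0 * \sum_j (1 - tbeta beta S j 0 - b) * u
    j 0.
  rewrite aimd_mulE; congr (_ + _ * _).
  under [RHS]eq_bigr do rewrite mulrBl.
  by rewrite sumrB -mulr_sumr bu subr0.
apply: (@le_trans _ _ (\sum_i (tbeta beta S i 0 * `|u i 0| +
    alpha i 0 * \sum_j (1 - tbeta beta S j 0 - b) * `|u j 0|))).
  apply: ler_sum => i _; rewrite E (le_trans (ler_normD _ _))// !normrM lerD//.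
    by rewrite ger0_norm//; case/andP: (tbeta_itv S i).
  rewrite ger0_norm; last exact: alpha_simplex.1.
  rewrite ler_wpM2l//; first exact: alpha_simplex.1.
  rewrite (le_trans (ler_norm_sum _ _ _))//; apply: ler_sum => j _.
  by rewrite normrM ger0_norm// subr_ge0.
rewrite big_split/= -mulr_suml (alpha_simplex.2) mul1r -big_split/= mulr_sumr.
by apply: ler_sum => i _; rewrite -mulrDl addrA [tbeta _ _ _ _ + _]addrC subrK.
Qed.

Definition col_norm1 (j : 'I_T.+1) z : R := \sum_i `|z i j|.

(* The weights [c ^+ j] turn the shift of the blocks into a contraction, so that
   one single step with the full back-off contracts. *)
Definition weighted_norm z : R :=
  \big[Num.max/0]_(j < T.+1) (c ^+ j * col_norm1 j z).

Definition weighted_dist x y : R := weighted_norm (x - y).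

Let col_norm1_ge0 j z : 0 <= col_norm1 j z.
Proof. by apply: sumr_ge0 => i _. Qed.

Let c_gt0 : 0 < c. Proof. by case/andP: c_itv. Qed.
Let c_le1 : c <= 1. Proof. by case/andP: c_itv => _ /ltW. Qed.

Let weighted_norm_leP z e : 0 <= e ->
  (forall j : 'I_T.+1, c ^+ j * col_norm1 j z <= e) -> weighted_norm z <= e.
Proof. by move=> e0 ze; apply/bigmax_leP; split. Qed.

Let weighted_norm_ge z (j : 'I_T.+1) : c ^+ j * col_norm1 j z <=
  weighted_norm z.
Proof. exact: (le_bigmax _ (fun j : 'I__ => c ^+ j * col_norm1 j z)). Qed.

Let weighted_norm_ge0 z : 0 <= weighted_norm z.
Proof.
apply: le_trans (weighted_norm_ge z ord0).
by rewrite mulr_ge0 ?col_norm1_ge0// exprn_ge0// ltW.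
Qed.

Lemma weighted_dist_ge0 x y : 0 <= weighted_dist x y.
Proof. exact: weighted_norm_ge0. Qed.

Lemma weighted_dist_le x y : weighted_dist x y <= n%:R * ndist x y.
Proof.
apply: weighted_norm_leP; first by rewrite mulr_ge0 ?ler0n// normr_ge0.
move=> j; rewrite (@le_trans _ _ (col_norm1 j (x - y)))//.
  by rewrite ler_piMl ?col_norm1_ge0// exprn_ile1// ltW.
rewrite (@le_trans _ _ (\sum_(i < n) ndist x y))//.
  by apply: ler_sum => i _; exact: ler_mx_coord.
by rewrite sumr_const card_ord mulr_natl.
Qed.

(** [c ^+ T] is the smallest of the weights. *)
Lemma coord_weighted_dist x y j :
  \sum_i `|x i j - y i j| <= (c ^+ T)^-1 * weighted_dist x y.
Proof.
rewrite ler_pdivlMl ?exprn_gt0//; apply: le_trans (weighted_norm_ge _ j).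
rewrite ler_pM ?exprn_ge0 ?(ltW c_gt0)//; first by apply: sumr_ge0.
  by rewrite ler_wiXn2l ?(ltW c_gt0)// -ltnS.
by apply: ler_sum => i _; rewrite !mxE.
Qed.

Lemma ndist_weighted_dist x y : ndist x y <= (c ^+ T)^-1 * weighted_dist x y.
Proof.
apply: ler_mx_normP => [|i j].
  by rewrite mulr_ge0 ?weighted_dist_ge0// invr_ge0 exprn_ge0// ltW.
apply: le_trans (coord_weighted_dist x y j).
by rewrite !mxE (bigD1 i)//= lerDl sumr_ge0.
Qed.

Lemma weighted_dist_simplexT x y : K x -> K y -> weighted_dist x y <= 2.
Proof.
move=> /simplexTP[x0 x1] /simplexTP[y0 y1]; apply: weighted_norm_leP => // j.
rewrite (@le_trans _ _ (col_norm1 j (x - y)))//.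
  by rewrite ler_piMl ?col_norm1_ge0// exprn_ile1// ltW.
rewrite (@le_trans _ _ (\sum_i (x i j + y i j)))//.
  apply: ler_sum => i _; rewrite !mxE (le_trans (ler_normB _ _))//.
  by rewrite !ger0_norm.
by rewrite big_split/= x1 y1.
Qed.

Lemma chain_stepB S x y :
  chain_step alpha beta S x - chain_step alpha beta S y =
  chain_step alpha beta S (x - y).
Proof.
have colB : col ord0 (x - y) = col ord0 x - col ord0 y.
  by apply/matrixP => i j; rewrite !mxE.
pose A := aimd_mx alpha beta S.
have stepE z i j : chain_step alpha beta S z i j =
    if j == ord0 then (A *m col ord0 z) i 0
    else j.+1%:R^-1 * (A *m col ord0 z) i 0 + j%:R / j.+1%:R * z i (inord j.-1).
  by rewrite mxE.
have AB i : (A *m col ord0 (x - y)) i 0 = (A *m col ord0 x) i 0 - (A *m col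
  ord0 y) i 0.
  by rewrite colB mulmxBr !mxE.
apply/matrixP => i j; rewrite [LHS]mxE [X in _ + X]mxE !stepE AB.
by case: ifP => // _; rewrite !mxE; ring.
Qed.

(** The bound on the image of block 0 passes to every block: the new block [j] is a convex
    combination, with coefficients 1/(j+1) and j/(j+1), of the new block 0 and the old block
    [j - 1], and for the latter the passage from weight [c ^+ (j - 1)] to [c ^+ j] gains a factor
    [c <= k]. It is applied with [k = 1] and with [k = c]. *)
Let weighted_norm_step S z k : c <= k <= 1 ->
  \sum_i `|(aimd_mx alpha beta S *m col ord0 z) i 0| <= k * col_norm1 ord0 z ->
  weighted_norm (chain_step alpha beta S z) <= k * weighted_norm z.
Proof.
move=> /andP[ck k1] Sk; have k0 : 0 <= k := le_trans (ltW c_gt0) ck.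
have z0 : col_norm1 ord0 z <= weighted_norm z.
  by have := weighted_norm_ge z ord0; rewrite expr0 mul1r.
apply: weighted_norm_leP => [|j]; first by rewrite mulr_ge0.
have [->|j0] := eqVneq j ord0.
  rewrite expr0 mul1r (le_trans _ (ler_wpM2l k0 z0))// (le_trans _ Sk)//.
  by apply: ler_sum => i _; rewrite !mxE eqxx.
have [j' jE] : exists j', j = j'.+1 :> nat.
  by exists j.-1; rewrite prednK// lt0n; apply: contra j0 => /eqP j0;
    apply/eqP/val_inj.
have j'T : (j' < T.+1)%N by rewrite ltnW// -jE.
pose N : R := j.+1%:R; have N0 : 0 < N by rewrite ltr0n.
have step : col_norm1 j (chain_step alpha beta S z) <=
    N^-1 * (k * col_norm1 ord0 z) + j%:R / N * col_norm1 (Ordinal j'T) z.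
  rewrite (le_trans _ (lerD (ler_wpM2l _ Sk) (lexx _))) ?invr_ge0 ?(ltW N0)//.
  rewrite mulr_sumr /col_norm1 mulr_sumr -big_split/=; apply: ler_sum => i _.
  rewrite !mxE (negbTE j0) (le_trans (ler_normD _ _))// !normrM !normfV.
  rewrite (ger0_norm (ltW N0)) (ger0_norm (ler0n _ _)).
  by rewrite (_ : inord j.-1 = Ordinal j'T)//; apply/val_inj;
    rewrite /= jE inordK.
apply: le_trans (ler_wpM2l _ step) _; first by rewrite exprn_ge0// ltW.
have h1 : c ^+ j * (k * col_norm1 ord0 z) <= k * weighted_norm z.
  rewrite mulrCA ler_wpM2l//; apply: le_trans z0.
  by rewrite ler_piMl ?col_norm1_ge0// exprn_ile1// ltW.
have h2 : c ^+ j * col_norm1 (Ordinal j'T) z <= k * weighted_norm z.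
  rewrite jE exprS -mulrA ler_pM ?(ltW c_gt0)//.
    by rewrite mulr_ge0 ?col_norm1_ge0// exprn_ge0// ltW.
  exact: (weighted_norm_ge z (Ordinal j'T)).
have -> : k * weighted_norm z = N^-1 * (k * weighted_norm z) + j%:R / N * (k *
  weighted_norm z).
  by rewrite -mulrDl -{1}[N^-1]mul1r -mulrDl addrC natr1 divff ?mul1r// gt_eqF.
rewrite mulrDr lerD//.
  by rewrite mulrCA ler_wpM2l// invr_ge0 ltW.
by rewrite mulrCA ler_wpM2l// divr_ge0 ?ler0n// ltW.
Qed.

Lemma chain_step_nonexpansive S x y :
  weighted_dist (chain_step alpha beta S x) (chain_step alpha beta S y) <=
  weighted_dist x y.
Proof.
rewrite /weighted_dist chain_stepB -[leRHS]mul1r.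
apply: weighted_norm_step; first by rewrite c_le1 lexx.
apply: le_trans (@aimd_norm1 S (col ord0 (x - y)) 0 _ _) _.
- by move=> i; rewrite subr_ge0; case/andP: (tbeta_itv S i).
- by rewrite mul0r.
- by rewrite subr0 !mul1r; apply: ler_sum => i _; rewrite mxE.
Qed.

(** In a full back-off every [1 - beta i 0] is at least [1 - c], and differences of points of the
    simplex have zero sum, so [aimd_norm1] holds with [b = 1 - c]. For an arbitrary [S] only [b = 0]
    is available. *)
Lemma chain_step_contraction x y : K x -> K y ->
  weighted_dist (chain_step alpha beta [set: 'I_n]%SET x)
    (chain_step alpha beta [set: 'I_n]%SET y) <=
  c * weighted_dist x y.
Proof.
move=> /simplexTP[x0 x1] /simplexTP[y0 y1]; rewrite /weighted_dist chain_stepB.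
apply: weighted_norm_step; first by rewrite c_le1 lexx.
apply: le_trans (@aimd_norm1 [set: 'I_n]%SET (col ord0 (x - y)) (1 - c) _ _) _.
- by move=> i; rewrite mxE finset.in_setT lerD2l lerN2.
- rewrite (_ : \sum_i _ = 0) ?mulr0//.
  under eq_bigr do rewrite !mxE.
  by rewrite sumrB x1 y1 subrr.
- rewrite subKr ler_wpM2l ?(ltW c_gt0)//.
  by apply: ler_sum => i _; rewrite mxE.
Qed.

Lemma chain_step_simplexT S z : K z -> K (chain_step alpha beta S z).
Proof.
move=> Kz; have [z0 z1] := (simplexTP z).1 Kz.
have u0 i : 0 <= (aimd_mx alpha beta S *m col ord0 z) i 0.
  by apply: aimd_ge0 => k; rewrite mxE.
have u1 : \sum_i (aimd_mx alpha beta S *m col ord0 z) i 0 = 1.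
  by rewrite aimd_sum -(z1 ord0); apply: eq_bigr => i _; rewrite mxE.
apply/simplexTP; split=> [i j|j].
  rewrite mxE; case: ifP => // _.
  by rewrite addr_ge0// mulr_ge0// ?divr_ge0 ?invr_ge0 ?ler0n.
have [->|j0] := eqVneq j ord0.
  by rewrite -[RHS]u1; apply: eq_bigr => i _; rewrite mxE.
rewrite (eq_bigr _ (fun i _ => mxE _ _ i j)) (negbTE j0).
rewrite big_split/= -!mulr_sumr u1 z1 !mulr1 -{1}[j.+1%:R^-1]mul1r -mulrDl
  addrC natr1.
by rewrite divff// pnatr_eq0.
Qed.

Lemma measurable_chain_step S :
  measurable_fun setT (chain_step alpha beta S : X -> X).
Proof.
apply: continuous_measurable_mx.
apply: (@lipschitz_continuous _ _ _ _ ((c ^+ T)^-1 * n%:R)) => x y.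
apply: le_trans (ndist_weighted_dist _ _) _; rewrite -mulrA.
rewrite ler_wpM2l ?invr_ge0 ?exprn_ge0 ?(ltW c_gt0)//.
exact: le_trans (chain_step_nonexpansive _ _ _) (weighted_dist_le _ _).
Qed.

Lemma bucont_weighted_dist f :
  bucont K weighted_dist f <-> bucont K (@ndist R X) f.
Proof.
split; first by apply: bucont_dist => [x y|x y _ _];
  [exact: normr_ge0|exact: weighted_dist_le].
apply: bucont_dist => [x y|x y _ _]; first exact: weighted_dist_ge0.
exact: ndist_weighted_dist.
Qed.

Lemma bucont_chain_step S f : bucont K (@ndist R X) f ->
  bucont K (@ndist R X) (f \o chain_step alpha beta S).
Proof.
rewrite -!bucont_weighted_dist => -[[M fM] fu]; split.
  by exists M => x Kx; apply: fM; exact: chain_step_simplexT.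
move=> e /fu[a a0 fa]; exists a => // x y Kx Ky xy.
apply: fa; [exact: chain_step_simplexT..|].
exact: le_lt_trans (chain_step_nonexpansive _ _ _) xy.
Qed.

End aimd.

(** * Stationary distribution of a contractive chain *)

Section contractive_chain.
Context {R : realType} {m n : nat} {I : finType}.
Local Notation X := 'M[R]_(m, n).
Local Notation bc K := (bucont K (@ndist R X)).
Variables (w : I -> X -> X) (p : I -> X -> R) (K : set X).
Hypothesis cK : compact K.
Hypothesis wK : forall s x, K x -> K (w s x).
Hypothesis mw : forall s, measurable_fun setT (w s).
Hypothesis wbc : forall s f, bc K f -> bc K (f \o w s).
Hypothesis pbc : forall s, bc K (p s).
Hypothesis p_ge0 : forall s x, K x -> 0 <= p s x.
Hypothesis p_sum1 : forall x, K x -> \sum_s p s x = 1.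

Let mK : measurable K := compact_measurable_mx cK.
Local Notation U := (transfer w p).

(** Contraction takes place in [d], the Riesz representation in the norm distance; the two are
    linked only by having the same uniformly continuous functions. *)
Lemma stationary_exists (d : X -> X -> R) (s0 : I) (c p0 L D : R) :
  K !=set0 -> (forall f, bucont K d f <-> bc K f) ->
  (forall x y, 0 <= d x y) -> (forall x y, K x -> K y -> d x y <= D) ->
  (forall s x y, K x -> K y -> d (w s x) (w s y) <= d x y) ->
  (forall x y, K x -> K y -> d (w s0 x) (w s0 y) <= c * d x y) ->
  0 <= c < 1 -> 0 < p0 < 1 -> (forall x, K x -> p0 <= p s0 x) ->
  (forall x y, K x -> K y -> \sum_s `|p s x - p s y| <= L * d x y) -> 0 <= L ->
  exists pi : probability X R, pi K = 1%E /\
    forall f, bc K f -> forall e, 0 < e -> exists N, forall k x, (N <= k)%N ->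
      K x ->
      `|iter k U f x - \int[pi]_(x in K) f x| <= e.
Proof.
move=> [x0 Kx0] dE d0 dD wd w0d c_itv p0_itv p_s0 pL L0.
pose Lam := transfer_lim w p x0.
have [f g /dE uf /dE ug|a f /dE uf|f g /dE uf /dE ug||pi [piK piE]] :=
    @riesz_representation R m n K Lam cK.
- exact: (transfer_limD wK p_ge0 p_sum1 d0 dD wd w0d c_itv p0_itv p_s0 pL L0
    Kx0).
- exact: (transfer_limZ wK p_ge0 p_sum1 d0 dD wd w0d c_itv p0_itv p_s0 pL L0
    Kx0).
- exact: (le_transfer_lim wK p_ge0 p_sum1 d0 dD wd w0d c_itv p0_itv p_s0 pL L0
    Kx0).
- exact: (transfer_lim_cst wK p_sum1 Kx0).
exists pi; split=> // f uf e e0; rewrite piE//.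
exact: (transfer_lim_unif wK p_ge0 p_sum1 d0 dD wd w0d c_itv p0_itv p_s0 pL L0
  Kx0
  ((dE f).2 uf) e0).
Qed.

Variable pi : probability X R.
Hypothesis piK : pi K = 1%E.
Hypothesis pi_unif : forall f, bc K f -> forall e, 0 < e ->
  exists N, forall k x,
  (N <= k)%N -> K x -> `|iter k U f x - \int[pi]_(x in K) f x| <= e.

Lemma iter_transfer_integral_cvg (mu : probability X R) f : mu K = 1%E ->
  bc K f ->
  \int[mu]_(x in K) iter k U f x @[k --> \oo] --> \int[pi]_(x in K) f x.
Proof.
move=> muK uf; apply/cvgrPdist_le => e e0; have [N fN] := pi_unif uf e0.
exists N => // k /= Nk; set a := \int[pi]_(x in K) f x.
have uk : bc K (iter k U f) by exact: bucont_iter_transfer.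
have ua : bc K (fun=> a) by exact: bucont_cst.
rewrite distrC -(Rintegral_cst_full a mK muK) -RintegralB//;
  [|exact: bucont_integrable..].
have ui : bc K (fun x => iter k U f x - a) by exact: bucontB.
apply: le_trans (le_normr_Rintegral mK (bucont_integrable mu mK ui)) _.
rewrite -(Rintegral_cst_full e mK muK); apply: le_Rintegral => //.
- apply: (@bucont_integrable _ _ _ mu K (fun x => `|iter k U f x - a|) mK).
  by apply: (@bucont_le _ _ _ _ _ _ 1) ui => x y _ _;
    rewrite mul1r ler_dist_dist.
- exact: (bucont_integrable mu mK (bucont_cst e)).
- by move=> x Kx; exact: fN.
Qed.

(** The integrals of [iter k.+1 U f] are those of the iterates of [f] shifted by one and also those
    of the iterates of [U f]; the two limits coincide. *)
Lemma stationary_transfer f : bc K f ->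
  \int[pi]_(x in K) U f x = \int[pi]_(x in K) f x.
Proof.
move=> uf; have := iter_transfer_integral_cvg piK uf;
  rewrite -cvg_shiftS/= => c1.
have uUf : bc K (U f) by exact: bucont_transfer.
have := iter_transfer_integral_cvg piK uUf.
under eq_fun do under eq_Rintegral do rewrite -iterSr.
move=> c2; exact: cvg_unique c2 c1.
Qed.

Lemma step_law_stationary C : measurable C -> step_law w p K pi C = pi C.
Proof.
have [nu [nuK nuE nuI]] := step_lawP cK wK mw wbc pbc p_ge0 p_sum1 piK.
move=> mC; rewrite -nuE//; apply: (eq_probability_bucont mK nuK piK) => // f uf.
by rewrite nuI// stationary_transfer.
Qed.

(** Under an invariant [mu] the integrals of [iter k U f] are constant in [k], while they converge
    to the integral against [pi]. *)
Lemma stationary_unique (mu : probability X R) : mu K = 1%E ->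
  (forall C, measurable C -> step_law w p K mu C = mu C) ->
  forall C, measurable C -> mu C = pi C.
Proof.
move=> muK muE; apply: (eq_probability_bucont mK muK piK) => // f uf.
have [nu [nuK nuE nuI]] := step_lawP cK wK mw wbc pbc p_ge0 p_sum1 muK.
have inv g : bc K g -> \int[mu]_(x in K) U g x = \int[mu]_(x in K) g x.
  move=> ug; rewrite -nuI// /Rintegral; congr fine.
  by apply: eq_integral_measurable => A mA; exact: etrans (nuE A mA) (muE A mA).
apply/esym; apply: cvg_unique (iter_transfer_integral_cvg muK uf) _ => //.
have -> : (fun k => \int[mu]_(x in K) iter k U f x) = fun=>
  \int[mu]_(x in K) f x.
  apply/funext; elim=> [//|k IH]; rewrite -IH.
  by apply: (inv (iter k U f)); exact: bucont_iter_transfer.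
exact: cvg_cst.
Qed.

End contractive_chain.

Lemma bucont_lipschitz (R : realType) (X : Type) (K : set X) (d : X -> X -> R)
    (f : X -> R) (M C : R) : (forall x y, 0 <= d x y) ->
  (forall x, K x -> `|f x| <= M) ->
  (forall x y, K x -> K y -> `|f x - f y| <= C * d x y) -> bucont K d f.
Proof.
move=> d0 fM fC; split=> [|e e0]; first by exists M.
have C0 : 0 < `|C| + 1 by rewrite ltr_wpDl.
exists (e / (`|C| + 1)) => [|x y Kx Ky xy]; first by rewrite divr_gt0.
apply: le_trans (fC _ _ Kx Ky) _; apply: (@le_trans _ _ ((`|C| + 1) * d x y)).
  by rewrite ler_wpM2r// (le_trans (ler_norm C))// lerDl.
by rewrite -ler_pdivlMl// mulrC ltW.
Qed.

Lemma cvg_mx_coord (R : realType) (m n : nat) (M_ : nat -> 'M[R]_(m, n))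
    (M : 'M[R]_(m, n)) :
  (forall i j, M_ k i j @[k --> \oo] --> M i j) -> M_ k @[k --> \oo] --> M.
Proof.
move=> MM; apply/cvg_ballP => e e0.
have : \forall k \near \oo, forall i j, ball (M i j) e (M_ k i j).
  apply: filter_forall => i; apply: filter_forall => j.
  by move/cvg_ballP : (MM i j); exact.
by apply: filterS => k Mk; split.
Qed.

(** Singletons are closed, so fixing a history is a finite intersection of generating events. The
    conditioning in [is_chain] thereby covers the histories used in the ergodic theorem. *)
Lemma chain_past_history (R : realType) (n T : nat) (d : measure_display)
    (Om : measurableType d) (z : nat -> Om -> 'M[R]_(n, T.+1)) k a :
  chain_past z k (history z k @^-1` [set a]).
Proof.
pose G := [set E | exists j (B : set 'M[R]_(n, T.+1)),
  [/\ (j <= k)%N, measurable B & E = z j @^-1` B]].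
suff h s b : {in s, forall j, (j <= k)%N} ->
    @measurable _ (g_sigma_algebraType G) [set om | [seq z j om | j <- s] = b].
  by apply: h => j; rewrite mem_iota ltnS => /andP[].
elim: s b => [|j s IH] b sk.
  case: b => [|x b]; first by rewrite (_ : mkset _ = setT)//; apply/seteqP;
    split.
  by rewrite (_ : mkset _ = set0)//; apply/seteqP; split.
case: b => [|x b]; first by rewrite (_ : mkset _ = set0)//; apply/seteqP; split.
rewrite (_ : mkset _ = z j @^-1` [set x] `&` [set om | [seq z j om | j <- s] =
  b]); last first.
  by apply/seteqP; split=> om /= [-> ->].
apply: measurableI; last by apply: IH => i si; apply: sk; rewrite inE si orbT.
apply: sub_sigma_algebra; exists j, [set x]; split=> //.
  by apply: sk; rewrite inE eqxx.
by apply: compact_measurable_mx; exact: compact_set1.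
Qed.

(** * Positivity, total mass and Lipschitz bound of the choice probabilities *)

Section choice_probabilities.
Context {R : realType} {n T : nat}.
Local Notation X := 'M[R]_(n, T.+1).
Local Notation K := (@simplexT R n T).
Variable lam : 'I_n -> R -> R.
Hypothesis lam_itv : forall i, {in `[0, 1], forall r, lam i r \in `[0, 1]}.
Implicit Types (S : {set 'I_n}) (x y z : X).

Let prob S z := aimd_prob lam S (col ord_max z).

Let factor S z i :=
  if i \in S then lam i (z i ord_max) else 1 - lam i (z i ord_max).

Let probE S z : prob S z = \prod_i factor S z i.
Proof.
rewrite /prob /aimd_prob [RHS](bigID (mem S))/=; congr (_ * _).
  by apply: eq_bigr => i iS; rewrite /factor iS mxE.
apply: eq_big => [i|i]; first by rewrite finset.in_setC.
by rewrite finset.in_setC /factor mxE => /negbTE ->.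
Qed.

Let lam01 z i : K z -> 0 <= lam i (z i ord_max) <= 1.
Proof. by move=> /simplexT_itv h; have := lam_itv i (h i ord_max);
  rewrite in_itv. Qed.

Let factor01 S z i : K z -> 0 <= factor S z i <= 1.
Proof.
move=> /(lam01 i) /andP[l0 l1]; rewrite /factor; case: ifP => _;
  first by rewrite l0.
by rewrite subr_ge0 l1 lerBlDr lerDl.
Qed.

Lemma aimd_prob_ge0 S z : K z -> 0 <= aimd_prob lam S (col ord_max z).
Proof.
move=> Kz; rewrite -/(prob S z) probE; apply: prodr_ge0 => i _.
by case/andP: (factor01 S i Kz).
Qed.

(** Expansion over subsets of the product of the factors [lam + (1 - lam)]. *)
Lemma aimd_prob_sum z : \sum_S aimd_prob lam S (col ord_max z) = 1.
Proof.
transitivity (\prod_i (lam i (z i ord_max) + (1 - lam i (z i ord_max)))).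
  rewrite bigA_distr/=.
  by apply: eq_big => [S|S _]; rewrite ?inE// -/(prob S z) probE.
by rewrite big1// => i _; rewrite subrKC.
Qed.

Lemma aimd_prob_setT lmin z : K z -> 0 <= lmin ->
  (forall i, {in `[0, 1], forall r, lmin <= lam i r}) ->
  lmin ^+ n <= aimd_prob lam [set: 'I_n]%SET (col ord_max z).
Proof.
move=> Kz l0 lmin_le; rewrite -/(prob _ z) probE -[in lmin ^+ n](card_ord n)
  -prodr_const.
apply: ler_prod => i _; rewrite l0 /factor finset.in_setT.
exact: lmin_le (simplexT_itv i ord_max Kz).
Qed.

Lemma aimd_prob_lipschitz C S x y : K x -> K y ->
  (forall i r s, r \in `[0, 1] -> s \in `[0, 1] ->
     `|lam i r - lam i s| <= C * `|r - s|) ->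
  `|aimd_prob lam S (col ord_max x) - aimd_prob lam S (col ord_max y)| <=
  C * \sum_i `|x i ord_max - y i ord_max|.
Proof.
move=> Kx Ky lamC; rewrite -/(prob S x) -/(prob S y) !probE.
rewrite (le_trans (prod_dist_le _ _ _))//; [by move=> i; exact: factor01..|].
rewrite mulr_sumr; apply: ler_sum => i _.
apply: le_trans (lamC i _ _ (simplexT_itv i ord_max Kx) (simplexT_itv i ord_max
  Ky)).
rewrite /factor; case: ifP => // _.
rewrite [X in `|X|](_ : _ = lam i (y i ord_max) - lam i (x i ord_max));
  last by ring.
by rewrite distrC.
Qed.

End choice_probabilities.

Theorem theorem4p2 (R : realType) (n : nat) (alpha beta : 'cV[R]_n)
    (lam : 'I_n -> R -> R)
    (alpha_ri : ri_simplex alpha)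
    (beta_itv : forall i, 0 < beta i 0 < 1)
    (alpha_beta : forall i j,
       alpha i 0 / (1 - beta i 0) = alpha j 0 / (1 - beta j 0))
    (lam_itv : forall i, {in `[0, 1], forall r, lam i r \in `[0, 1]})
    (A1 : forall i, {within `[0, 1], continuous (lam i)})
    (A2 : forall i,
       {in `[0, 1] &, {homo (fun r : R => r * lam i r) : r s / r < s}})
    (A3 : exists2 lmin : R, 0 < lmin
          & forall i, {in `[0, 1], forall r, lmin <= lam i r})
    (lam_lip : forall i, [lipschitz lam i r | r in `[0, 1]])
    (T : nat) :
  exists pi : probability 'M[R]_(n, T.+1) R,
    [/\ pi (@simplexT R n T) = 1%E,
        invariant_prob alpha beta lam pi,
        attractive_prob alpha beta lam pi,
        forall pi' : probability 'M[R]_(n, T.+1) R,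
          pi' (@simplexT R n T) = 1%E -> invariant_prob alpha beta lam pi' ->
          forall C : set 'M[R]_(n, T.+1), measurable C -> pi' C = pi C
      & forall (d : measure_display) (Om : measurableType d)
          (P : probability Om R) (z0 : 'M[R]_(n, T.+1))
          (S : nat -> Om -> {set 'I_n}) (z : nat -> {mfun Om >-> 'M[R]_(n, T.+1)}),
          simplexT z0 -> is_chain alpha beta lam P z0 S z ->
          {ae P, forall w,
             (fun k : nat => k%:R^-1 *: \sum_(0 <= l < k.+1) z l w) @ \oo -->
             (\matrix_(i, j) (\int[pi]_(x in @simplexT R n T) x i j)
                : 'M[R]_(n, T.+1))}].
Proof.
have alpha_simplex := alpha_ri.1.
have [lmin lmin0 lmin_le] := A3.
have beta_ge0 i : 0 <= beta i 0 by case/andP: (beta_itv i) => /ltW.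
(* The entries of [alpha] sum to 1, so there is at least one agent; [i0] provides the initial value
   of the maximum defining [c] and makes [c] positive. *)
have [i0 _] : exists i0 : 'I_n, True.
  have [|i0] := pickP (fun _ : 'I_n => true); first by move=> i0 _; exists i0.
  have := alpha_simplex.2; rewrite big1 => [/eqP|i _]; last by have := i0 i.
  by rewrite eq_sym oner_eq0.
have [c c_itv beta_le] : exists2 c : R, 0 < c < 1 & forall i, beta i 0 <= c.
  exists (\big[Num.max/beta i0 0]_i beta i 0); last first.
    by move=> i; exact: (le_bigmax _ (fun i => beta i 0) i).
  apply/andP; split.
    by rewrite (lt_le_trans _ (le_bigmax _ (fun i => beta i 0) i0))//;
      case/andP: (beta_itv i0).
  by apply/bigmax_ltP; split=> [|i _]; [case/andP: (beta_itv i0)|case/andP: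
    (beta_itv i)].
have [C C0 lamC] : exists2 C, 0 <= C & forall i r s, r \in `[0, 1] ->
  s \in `[0, 1] ->
    `|lam i r - lam i s| <= C * `|r - s|.
  have /choice[M MP] i : exists M, 0 <= M /\
      forall r s, r \in `[0, 1] -> s \in `[0, 1] -> `|lam i r - lam i s| <=
        M * `|r - s|.
    have [M0 [_ lipM]] := lam_lip i; exists (`|M0| + 1); split;
      first by rewrite addr_ge0.
    by move=> r s r01 s01; apply: (lipM (`|M0| + 1) _ (r, s));
      rewrite // ltr_pwDr// ler_norm.
  (* The sum of the individual Lipschitz constants dominates each of them. *)
  exists (\sum_i M i) => [|i r s r01 s01]; first by apply: sumr_ge0 => i _;
    case: (MP i).
  apply: le_trans ((MP i).2 r s r01 s01) _; rewrite ler_wpM2r// (bigD1 i)//=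
    lerDl.
  by apply: sumr_ge0 => j _; case: (MP j).
pose K := @simplexT R n T.
pose p (S : {set 'I_n}) (z : 'M[R]_(n, T.+1)) :=
  aimd_prob lam S (col ord_max z).
pose w (S : {set 'I_n}) := chain_step alpha beta S : 'M[R]_(n, T.+1) ->
  'M[R]_(n, T.+1).
pose dist := @weighted_dist R n T c.
have cK : compact K by exact: compact_simplexT.
have mK : measurable K := compact_measurable_mx cK.
have wK S x : K x -> K (w S x) by exact: (chain_step_simplexT alpha_simplex
  beta_ge0 beta_le c_itv).
have p_ge0 S x : K x -> 0 <= p S x by exact: aimd_prob_ge0.
have p_sum1 x : K x -> \sum_S p S x = 1 by move=> _; exact: aimd_prob_sum.
pose L := C * (c ^+ T)^-1 *+ #|{: {set 'I_n}}|.
have c_gt0 : 0 < c by case/andP: c_itv.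
have p_lip1 S x y : K x -> K y -> `|p S x - p S y| <=
  C * (c ^+ T)^-1 * dist x y.
  move=> Kx Ky; apply: le_trans (aimd_prob_lipschitz lam_itv S Kx Ky lamC) _.
  by rewrite -mulrA ler_wpM2l//; exact: coord_weighted_dist.
have p_lip x y : K x -> K y -> \sum_S `|p S x - p S y| <= L * dist x y.
  move=> Kx Ky; rewrite /L mulrnAl -sumr_const.
  by apply: ler_sum => S _; exact: p_lip1.
have L0 : 0 <= L by rewrite mulrn_wge0// mulr_ge0// invr_ge0 exprn_ge0// ltW.
(* The contraction argument needs [p0 < 1], and [lmin ^+ n] may equal 1; hence the cap at one
   half. *)
pose p0 := Num.min (lmin ^+ n) (2^-1 : R).
have p0_itv : 0 < p0 < 1.
  rewrite /p0 lt_min exprn_gt0//= invr_gt0 ltr0n/=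
    gt_min invf_lt1 ?ltr1n ?orbT//.
have p_full x : K x -> p0 <= p [set: 'I_n]%SET x.
  move=> Kx; rewrite ge_min; apply/orP; left.
  exact: aimd_prob_setT Kx (ltW lmin0) lmin_le.
have dist_ge0 x y : 0 <= dist x y by exact: weighted_dist_ge0.
have distK x y : K x -> K y -> dist x y <= 2 by exact: weighted_dist_simplexT.
have wd S x y : K x -> K y -> dist (w S x) (w S y) <= dist x y.
  by move=> _ _; exact: chain_step_nonexpansive.
have w0d x y : K x -> K y -> dist (w [set: 'I_n]%SET x) (w [set:
  'I_n]%SET y) <= c * dist x y.
  exact: chain_step_contraction.
have c_itv' : 0 <= c < 1 by case/andP: c_itv => /ltW ->.
have pS1 S x : K x -> `|p S x| <= 1.
  move=> Kx; rewrite ger0_norm ?p_ge0// -(p_sum1 x Kx) (bigD1 S)//= lerDl.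
  by apply: sumr_ge0 => S' _; exact: p_ge0.
have distE f : bucont K dist f <-> bucont K (@ndist R _) f.
  exact: bucont_weighted_dist.
have pbc S : bucont K (@ndist R _) (p S).
  by apply/distE; apply: (bucont_lipschitz dist_ge0 (pS1 S) (p_lip1 S)).
have wbc S f : bucont K (@ndist R _) f -> bucont K (@ndist R _) (f \o w S).
  exact: (bucont_chain_step alpha_simplex beta_ge0 beta_le c_itv).
have mw S : measurable_fun setT (w S).
  exact: (measurable_chain_step alpha_simplex beta_ge0 beta_le c_itv).
have K0 : K !=set0.
  exists (\matrix_(i, j) alpha i 0); apply/simplexTP; split=> [i j|j].
    by rewrite mxE; exact: alpha_simplex.1.
  by rewrite -alpha_simplex.2; apply: eq_bigr => i _; rewrite mxE.
have [pi [piK pi_unif]] := stationary_exists cK wK p_ge0 p_sum1 K0 distE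
  dist_ge0 distK wd w0d c_itv' p0_itv p_full p_lip L0.
(* At each time [chain_law] is replaced by a probability measure with the same Borel values, to
   which the next step and the duality with the transfer operator apply. *)
have chain_lawE (mu : probability 'M[R]_(n, T.+1) R) k : mu K = 1%E ->
    exists nu : probability 'M[R]_(n, T.+1) R, [/\ nu K = 1%E,
      forall C, measurable C -> chain_law alpha beta lam mu k C = nu C
    & forall f, bucont K (@ndist R _) f ->
      \int[nu]_(x in K) f x = \int[mu]_(x in K) iter k (transfer w p) f x].
  move=> muK; elim: k => [|k [nu [nuK nuE nuI]]]; first by exists mu.
  have [nu' [nu'K nu'E nu'I]] := step_lawP cK wK mw wbc pbc p_ge0 p_sum1 nuK.
  exists nu'; split=> // [B mB|f uf]; last first.
    rewrite nu'I// nuI; first by apply: eq_Rintegral => x _; rewrite -iterSr.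
    exact: (bucont_transfer wbc pbc).
  by rewrite nu'E//; exact: eq_integral_measurable.
exists pi; split=> //.
- by move=> B mB; exact: (step_law_stationary cK wK mw wbc pbc p_ge0 p_sum1 piK
    pi_unif).
- move=> mu muK f cf _; have uf := within_continuous_bucont cK cf.
  have EFinI (nu : probability 'M[R]_(n, T.+1) R) :
      (\int[nu]_(x in K) (f x)%:E)%E = (\int[nu]_(x in K) f x)%:E.
    rewrite /Rintegral fineK//; apply: integrable_fin_num => //.
    exact: (bucont_integrable nu mK uf).
  have -> : (fun k => \int[chain_law alpha beta lam mu k]_(x in K) (f x)%:E)%E =
      (fun k => (\int[mu]_(x in K) iter k (transfer w p) f x)%:E).
    apply/funext => k; have [nu [nuK nuE nuI]] := chain_lawE mu k muK.
    by rewrite -nuI// -EFinI; exact: eq_integral_measurable.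
  rewrite EFinI; apply: cvg_EFin; first exact: nearW.
  exact: (iter_transfer_integral_cvg cK wbc pbc pi_unif muK uf).
- move=> pi' pi'K pi'inv.
  exact: (stationary_unique cK wK mw wbc pbc p_ge0 p_sum1 piK pi_unif pi'K
    pi'inv).
- move=> d Om P z0 S z Kz0 [mS zE0 zES PS].
  have m_past k E : chain_past z k E -> measurable E.
    apply: smallest_sub; first exact: sigma_algebra_measurable.
    move=> _ [j [B [_ mB ->]]].
    by rewrite -[X in measurable X]setTI; exact: (measurable_funPT (z j)).
  have history_past := @chain_past_history R n T d Om (fun k om => z k om).
  have fK i j x : K x -> `|x i j| <= 1.
    by move=> /(simplexT_itv i j); rewrite in_itv/= => /andP[x0 x1];
      rewrite ger0_norm.
  have uc i j : bucont K (@ndist R _) (fun x : 'M[R]_(n, T.+1) => x i j).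
    apply: (@bucont_lipschitz _ _ _ _ _ 1 1) => // [x y|x|x y _ _].
    - exact: normr_ge0.
    - exact: fK.
    - by rewrite mul1r; have := ler_mx_coord (x - y) i j; rewrite !mxE.
  (* The matrix-valued limit is reduced to its finitely many coordinates, which are bounded by 1 on
     [K]. *)
  have coord i j : {ae P, forall om,
      k%:R^-1 * \sum_(0 <= l < k.+1) z l om i j @[k --> \oo] -->
        \int[pi]_(x in K) x i j}.
    apply: (@chain_ergodic _ _ _ _ _ P w p K z0 S (fun k om =>
      z k om) wK p_ge0 p_sum1
      Kz0 mS zE0 zES _ _ (fun x => x i j) 1).
    + by move=> k a; exact: m_past (history_past k a).
    + by move=> k s a; exact: PS (history_past k a).
    + by move=> x; exact: fK.
    + move=> e e0; have [N NP] := pi_unif _ (uc i j) e e0.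
      by exists N => x; exact: NP.
  have : {ae P, forall om, forall i j,
      k%:R^-1 * \sum_(0 <= l < k.+1) z l om i j @[k --> \oo] -->
        \int[pi]_(x in K) x i j}.
    by apply: filter_forall => i; apply: filter_forall => j; exact: coord.
  apply: filterS => om cvg_coord; apply: cvg_mx_coord => i j; rewrite mxE.
  under eq_fun do rewrite mxE summxE.
  exact: cvg_coord.
Qed.
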